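(* Let $\Gamma_1,\Gamma_2,p\colon\mathbb{R}\to\mathbb{R}$ be BPUC functions with $\Gamma_2-\Gamma_1$ nondecreasing, and let $\lambda_i:=\lambda^*(2\Gamma_i,\,p-\Gamma_i^2)$ for $i=1,2$. (i) If $\Gamma_2-\Gamma_1$ is continuous, then $\lambda_1\le\lambda_2$. If, in addition, $\Gamma_2-\Gamma_1$ is absolutely continuous and nonconstant on a nondegenerate interval, and $\lambda_1=\lambda_2$, then $y'=-(y-\Gamma_1(t))^2+p(t)+\lambda_1$ has infinitely many bounded solutions (but no hyperbolic ones), and the same happens for all the equations $y'=-(y-\Gamma_\mu(t))^2+p(t)+\lambda_\mu$ for $\mu\in(0,1)$, where $\Gamma_\mu:=\mu\,\Gamma_1+(1-\mu)\,\Gamma_2$ and $\lambda_\mu:=\lambda^*(2\Gamma_\mu,\,p-\Gamma_\mu^2)$. (ii) Assume that $\Gamma_1$ and $\Gamma_2$ have finite asymptotic limits (that is, $\lim_{t\to\pm\infty}\Gamma_i(t)$ exist and are finite for $i=1,2$). Then $\lambda_1\le\lambda_2$.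
   Context: BPUC functions: a set $\Delta=\{a_j\mid j\in\mathbb{Z}\}\subset\mathbb{R}$ is disperse if $\inf_{j\in\mathbb{Z}}(a_{j+1}-a_j)>0$. $BPUC_\Delta(\mathbb{R},\mathbb{R})$ is the set of bounded right-continuous functions $q\colon\mathbb{R}\to\mathbb{R}$ such that for all $\varepsilon>0$ there is $\delta>0$ such that, if $t_1,t_2\in(a_j,a_{j+1})$ for some $j\in\mathbb{Z}$ and $|t_2-t_1|<\delta$, then $|q(t_2)-q(t_1)|<\varepsilon$. A function $q$ is BPUC if $q=q_1+\cdots+q_n$ with $q_i\in BPUC_{\Delta_i}(\mathbb{R},\mathbb{R})$ for finitely many disperse sets $\Delta_1,\dots,\Delta_n$. Bifurcation value: for BPUC functions $q,p$, $\lambda^*(q,p)$ is the unique real number such that $x'=-x^2+q(t)x+p(t)+\lambda$ has a bounded solution if and only if $\lambda\ge\lambda^*(q,p)$ (such a number exists). Thus $\lambda^*(2\Gamma,p-\Gamma^2)$ is the corresponding value for $y'=-(y-\Gamma(t))^2+p(t)+\lambda$. Solutions are in the Carathéodory sense (absolutely continuous on compact intervals, satisfying the equation a.e.); ''bounded solution'' means globally defined and bounded on $\mathbb{R}$. A bounded solution $\tilde b$ of $y'=-(y-\Gamma(t))^2+p(t)+\lambda$ is hyperbolic if there exist $k\ge1$, $\beta>0$ with either $\exp\int_s^t(-2\tilde b(l)+2\Gamma(l))\,dl\le k e^{-\beta(t-s)}$ whenever $t\ge s$, or $\exp\int_s^t(-2\tilde b(l)+2\Gamma(l))\,dl\le k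 e^{\beta(t-s)}$ whenever $t\le s$. *)

(* Defs.v *)
From HB Require Import structures.
From mathcomp Require Import all_boot all_order all_algebra.
From mathcomp Require Import all_classical all_reals all_analysis.

Set Implicit Arguments.
Unset Strict Implicit.
Unset Printing Implicit Defensive.
Import Order.TTheory GRing.Theory Num.Theory.
Import numFieldNormedType.Exports.

Local Open Scope classical_set_scope.
Local Open Scope ring_scope.

Section BPUC.
Variable R : realType.
Implicit Types (a : int -> R) (q : R -> R).

(* The set Delta = {a_j | j in Z} is given by its enumeration a.
   [inf] is 0 on a set with no lower bound, so 0 < inf forces a lower bound. *)
Definition disperse a : Prop :=
  0 < inf (range (fun j : int => a (j + 1) - a j)).

Definition BPUC_on a q : Prop :=
  [/\ bounded_fun q,
      right_continuous q &
      forall e : R, 0 < e -> exists2 d : R, 0 < d &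
        forall (j : int) (t1 t2 : R),
          t1 \in `]a j, a (j + 1)[ -> t2 \in `]a j, a (j + 1)[ ->
          `|t2 - t1| < d -> `|q t2 - q t1| < e].

Definition BPUC q : Prop :=
  exists (n : nat) (a : 'I_n.+1 -> int -> R) (q_ : 'I_n.+1 -> R -> R),
    (forall i, disperse (a i) /\ BPUC_on (a i) (q_ i)) /\
    (forall t, q t = \sum_(i < n.+1) q_ i t).

End BPUC.

Section ODE.
Variable R : realType.
Implicit Types (f : R -> R -> R) (q p G x y : R -> R) (l : R).

Definition abs_continuous (u v : R) x : Prop :=
  forall e : R, 0 < e -> exists2 d : R, 0 < d &
    forall (n : nat) (c d_ : 'I_n -> R),
      (forall i, [/\ u <= c i, c i <= d_ i & d_ i <= v]) ->
      (forall i j, i != j -> d_ i <= c j \/ d_ j <= c i) ->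
      \sum_(i < n) (d_ i - c i) < d ->
      \sum_(i < n) `|x (d_ i) - x (c i)| < e.

(* Global Caratheodory solution of x' = f(t, x). *)
Definition solution f x : Prop :=
  (forall u v : R, u <= v -> abs_continuous u v x) /\
  {ae @lebesgue_measure R, forall t : R, is_derive t 1 x (f t (x t))}.

Definition bounded_solution f x : Prop := solution f x /\ bounded_fun x.

Definition riccati q p l (t x : R) : R := - x ^+ 2 + q t * x + p t + l.

Definition lambda_star q p : R :=
  get [set l0 : R | forall l : R,
    (exists x, bounded_solution (riccati q p l) x) <-> l0 <= l].

Definition shifted_riccati G p l (t y : R) : R := - (y - G t) ^+ 2 + p t + l.

Definition lambda_star_shifted G p : R :=
  lambda_star (fun t => 2 * G t) (fun t => p t - G t ^+ 2).

Definition oriented_integral (s t : R) (g : R -> R) : R :=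
  if s <= t then \int[@lebesgue_measure R]_(z in `[s, t]) g z
  else - \int[@lebesgue_measure R]_(z in `[t, s]) g z.

Definition hyperbolic G y : Prop :=
  let E (s t : R) :=
    expR (oriented_integral s t (fun z => - 2 * y z + 2 * G z)) in
  exists k b : R, [/\ 1 <= k, 0 < b &
    (forall s t, s <= t -> E s t <= k * expR (- b * (t - s))) \/
    (forall s t, t <= s -> E s t <= k * expR (b * (t - s)))].

Definition infinitely_many_bounded_none_hyperbolic G p l : Prop :=
  infinite_set [set y | bounded_solution (shifted_riccati G p l) y] /\
  (forall y, bounded_solution (shifted_riccati G p l) y -> ~ hyperbolic G y).

End ODE.

(* Main.v *)
Require Import Defs.
From HB Require Import structures.
From mathcomp Require Import all_boot all_order all_algebra.
From mathcomp Require Import all_classical all_reals all_analysis.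
From mathcomp Require Import measurable_realfun.
From mathcomp Require Import ring lra.

Set Implicit Arguments.
Unset Strict Implicit.
Unset Printing Implicit Defensive.
Import Order.TTheory GRing.Theory Num.Theory.
Import numFieldNormedType.Exports.

Local Open Scope classical_set_scope.
Local Open Scope ring_scope.

(** The comparison of the bifurcation values rests on one observation. Write
D = G2 - G1 and let y be a bounded solution for G2 at the parameter l. Then
z = y - D satisfies z - G1 = y - G2, and it moves like y except that the
nondecreasing function D is subtracted: z is a lower solution for G1 at the
same l. Between a bounded lower solution and a large constant there is a
bounded solution, so that every l admissible for G2 is admissible for G1,
which is lambda1 <= lambda2.

Lower solutions are handled through an integral operator instead of a
differential inequality. For K > 0 let [relax K g] be the bounded solution of
r' + K r = g, that is, r(t) = int_(-oo)^t exp (-K (t - s)) g(s) ds. A bounded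
solution of y' = f(t, y) is a fixed point of y |-> relax K (f(., y) + K y), and
a lower solution is a z below its own image. When K is large the operator is
monotone on functions bounded above by a given constant; iterating it from a
large constant gives a decreasing sequence whose limit is, by dominated
convergence, the greatest bounded solution, and it lies above every lower
solution ([greatest_bounded_solution]). This replaces the whole theory of the
initial value problem. The same limiting argument, applied to greatest
solutions for parameters decreasing to the infimum, shows that the admissible
parameters form a closed half-line, so that the bifurcation value is
characterised as expected ([lambda_star_shiftedP]).

Passing from Caratheodory solutions to fixed points needs one fact on
absolutely continuous functions: nonnegative derivative almost everywhere
implies nondecreasing ([ac_ae_derive_ge0]). It makes bounded solutions
Lipschitz, after which only Lipschitz functions occur.

Suppose now that the bifurcation values agree and that D is not constant, say
D(u) < D(v) with u < v. The greatest bounded solution b for G1 then satisfies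
b(v) > z(v), since the image of z under the operator is strictly above z at v.
Reversing time, y(t) |-> -y(-t), turns the equation into one of the same form
and greatest solutions into least ones, so that the least bounded solution a
lies below z. Hence a(v) < b(v), and the general solution of the Riccati
equation in terms of the two particular ones a <= b provides infinitely many
bounded solutions in between ([infinitely_many_between]). None of them can be
hyperbolic: if y is hyperbolic and attractive, then phi' = c phi + 1 with
c = -2 y + 2 G has a bounded solution phi >= 0, and y - delta phi is a lower
solution for a slightly smaller parameter, against the minimality of the
bifurcation value; the repulsive case is the time reversal of this one. The
intermediate equations are reduced to the same situation with the pair Gmu, G2,
because G2 - Gmu = mu D and because the bifurcation value for Gmu is squeezed
between lambda1 and lambda2. *)

(** * Functions with nonnegative derivative almost everywhere *)

Section monotone.
Variable R : realType.
Local Notation mu := (@lebesgue_measure R).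
Implicit Types (x g : R -> R).

Let le_mu (A B : set R) : measurable A -> measurable B -> A `<=` B ->
  (mu A <= mu B)%E.
Proof. by move=> mA mB AB; apply: le_measure => //; rewrite inE. Qed.

(** A form of the compactness of [u, v]: a property that propagates across a
neighbourhood of every point propagates from u to v, as one sees at the
supremum of the points that it has reached. *)
Lemma interval_induction (P : R -> Prop) (u v : R) : u <= v -> P u ->
  (forall s, u <= s <= v -> exists2 r : R, 0 < r & forall y y', u <= y -> y' <= v ->
     s - r < y <= s -> s <= y' < s + r -> P y -> P y') ->
  P v.
Proof.
move=> uv Pu step.
pose S := [set t | u <= t <= v /\ P t].
have Su : S u by split; rewrite ?lexx.
have ubS : ubound S v by move=> t [/andP[]].
have hsS : has_sup S by split; [exists u|exists v].
have us : u <= sup S by apply: ub_le_sup => //; exists v.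
have sv : sup S <= v by apply: ge_sup => //; exists u.
have [|r r0 hr] := step (sup S); first by rewrite us.
have [y [/andP[uy yv] Py] sy] := sup_adherent r0 hsS.
have ys : y <= sup S by apply: ub_le_sup; [exists v|split=> //; rewrite uy].
pose y' := Num.min v (sup S + r / 2).
have sy' : sup S <= y' by rewrite le_min sv /= lerDl divr_ge0 // ltW.
have Py' : P y'.
  apply: (hr y) => //; rewrite ?ge_min ?lexx ?sy ?ys //.
  by rewrite sy' gt_min (ltrD2l (sup S)) [r / 2 < r](_ : _ = true) ?orbT //; lra.
have : y' <= sup S.
  apply: ub_le_sup; first by exists v.
  by split=> //; rewrite (le_trans us sy') ge_min lexx.
rewrite ge_min => /orP[vs|]; last by lra.
by move: Py'; rewrite /y' min_l //; lra.
Qed.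

Lemma near_derivative_ge0 x (s d e : R) : 0 < e -> 0 <= d -> is_derive s 1 x d ->
  exists2 r : R, 0 < r & forall y y',
     s - r < y <= s -> s <= y' < s + r -> - e * (y' - y) <= x y' - x y.
Proof.
move=> e0 d0 [dx xd].
have : h^-1 *: ((x \o shift s) (h *: 1) - x s) @[h --> 0^'] --> d.
  by rewrite -xd; exact: dx.
move/cvgrPdist_lt => /(_ e e0) [r /= r0 hr].
have key h : `|h| < r -> - e * `|h| <= (x (s + h) - x s) * Num.sg h.
  move=> hlt; have [->|h0] := eqVneq h 0.
    by rewrite normr0 sgr0 !mulr0.
  have := hr h; rewrite /ball_ /= sub0r normrN => /(_ hlt h0).
  rewrite /= [h *: 1]mulr1 ltr_norml => /andP[_ ].
  rewrite ltrBlDr -ltrBlDl => H.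
  have -> : (x (s + h) - x s) * Num.sg h =
      h^-1 * (x (h + s) - x s) * `|h|.
    rewrite [in RHS]normrEsg (addrC h s); field.
    exact: h0.
  rewrite ler_wpM2r //.
  have : d - e < h^-1 *: (x (h + s) - x s) by [].
  rewrite /GRing.scale /=; lra.
exists r => // y y' /andP[ry ys] /andP[sy' yr].
have h1 : - e * (y' - s) <= x y' - x s.
  have [->|ne] := eqVneq y' s; first by rewrite !subrr mulr0.
  have yp : 0 < y' - s by rewrite subr_gt0 lt_neqAle eq_sym ne.
  have := key (y' - s); rewrite gtr0_norm // gtr0_sg // mulr1 subrKC.
  by apply; lra.
have h2 : - e * (s - y) <= x s - x y.
  have [->|ne] := eqVneq y s; first by rewrite !subrr mulr0.
  have yp : y - s < 0 by rewrite subr_lt0 lt_neqAle ne.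
  have := key (y - s); rewrite ltr0_norm // ltr0_sg // mulrN1 subrKC !opprB.
  by apply; lra.
lra.
Qed.

(** Cover the exceptional null set by an open set U of measure less than the d
that absolute continuity associates with e. Away from U the function loses at
most e per unit of length near each point; inside U the total loss on disjoint
intervals is less than e. [interval_induction] joins the two kinds of local
estimates, the property carried along being the existence of a finite list of
disjoint intervals inside U that accounts for the loss so far. *)
Lemma ac_ae_derive_ge0 x (u v : R) : u <= v -> abs_continuous u v x ->
  {ae mu, forall t : R, u < t < v -> exists2 d : R, 0 <= d & is_derive t 1 x d} ->
  x u <= x v.
Proof.
move=> uv acx aex.
suff H : forall e : R, 0 < e -> x u - x v <= e * (v - u + 1).
  rewrite -subr_le0; apply/ler_addgt0Pr => e e0; rewrite add0r.
  have vu : 0 < v - u + 1 by lra.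
  by have := H (e / (v - u + 1)); rewrite divr_gt0 // divfK ?gt_eqF //; apply.
move=> e e0; have [d d0 hd] := acx e e0.
(* The endpoints join the exceptional set, since nothing is known there about
   the two-sided derivative. *)
pose N := ~` [set t | u < t < v -> exists2 d : R, 0 <= d & is_derive t 1 x d]
   `|` ([set u] `|` [set v]).
have N0 : mu.-negligible N.
  have N1 w : mu.-negligible [set w].
    by exists [set w]; split=> //; apply: lebesgue_measure_set1.
  by apply: negligibleU; [exact: aex|exact: negligibleU].
have d20 : 0 < d / 2 by lra.
have [U [oU NU]] := outer_measure_open_le N d20.
rewrite (negligible_outer_measure N).1 // add0e => mUd.
have mU : measurable U by exact: open_measurable.
have mUt t : measurable (U `&` `]u, t]) by apply: measurableI.
pose m t := fine (mu (U `&` `]u, t])).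
have fin t : mu (U `&` `]u, t]) \is a fin_num.
  rewrite ge0_fin_numE //; apply: (@le_lt_trans _ _ (mu U)).
    by apply: le_mu => //; exact: subIsetl.
  by apply: le_lt_trans mUd _; rewrite ltry.
have mle t : m t < d.
  rewrite -lte_fin fineK //; apply: (@le_lt_trans _ _ (mu U)).
    by apply: le_mu => //; exact: subIsetl.
  by apply: le_lt_trans mUd _; rewrite lte_fin; lra.
have mmono y y' : y <= y' -> m y <= m y'.
  move=> yy'; apply: fine_le => //; apply: le_mu => //.
  apply: setIS => t /=; rewrite !in_itv /= => /andP[-> ty].
  exact: le_trans yy'.
have madd y y' : u <= y -> y <= y' -> `]y, y'] `<=` U -> m y + (y' - y) <= m y'.
  move=> uy yy' yU; rewrite -lee_fin EFinD !fineK //.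
  have -> : (y' - y)%:E = mu `]y, y'].
    rewrite lebesgue_measure_itv /= lte_fin; case: ltgtP yy' => // -> _.
    by rewrite subrr.
  rewrite -measureU //; [|exact: mUt|]; last first.
    rewrite -subset0 => t /= [[_]]; rewrite !in_itv /= => /andP[_ ty] /andP[yt _].
    by have := lt_le_trans yt ty; rewrite ltxx.
  apply: le_mu => //; first exact: measurableU.
  move=> t [[Ut]|] /=; rewrite !in_itv /= => /andP[h1 h2].
    by split=> //; rewrite h1 (le_trans h2).
  by split; [apply: yU; rewrite /= in_itv /= h1|rewrite (le_lt_trans uy)].
(* The length of the listed intervals is bounded by m, which measures U on
   the part already covered, rather than by d: this bound is additive. *)
pose P t := exists l : seq (R * R),
  [/\ all (fun i => [&& u <= i.1, i.1 <= i.2 & i.2 <= t]) l,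
      pairwise (fun i j => i.2 <= j.1) l,
      \sum_(i <- l) (i.2 - i.1) <= m t &
      - e * (t - u) - \sum_(i <- l) `|x i.2 - x i.1| <= x t - x u].
have : P v.
  apply: (interval_induction uv).
    exists [::]; split; rewrite ?big_nil //; first by rewrite fine_ge0.
    by rewrite !subrr mulr0 subr0.
  move=> s /andP[us sv].
  have weak y y' : u <= y -> y <= y' -> - e * (y' - y) <= x y' - x y -> P y -> P y'.
    move=> uy yy' xyy' [l [la lp lm lx]]; exists l; split => //.
    - apply: sub_all la => i /and3P[-> -> /=] /le_trans; exact.
    - exact: le_trans (mmono _ _ yy').
    - lra.
  have [Us|nUs] := pselect (U s); last first.
    have [nNs us' vs'] : [/\ ~ (~` [set t | u < t < v ->
        exists2 d : R, 0 <= d & is_derive t 1 x d]) s, s != u & s != v].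
      split; first by move=> h; apply: nUs; apply: NU; left.
      - by apply/eqP => h; apply: nUs; apply: NU; right; left.
      - by apply/eqP => h; apply: nUs; apply: NU; right; right.
    have H : u < s < v -> exists2 d : R, 0 <= d & is_derive s 1 x d.
      by apply: contrapT => nH; exact: nNs.
    have [|d' d'0 xd] := H.
      by rewrite !lt_neqAle us sv vs' eq_sym us'.
    have [r r0 hr] := near_derivative_ge0 e0 d'0 xd.
    exists r => // y y' uy y'v h1 h2; apply: weak => //; last exact: hr.
    by case/andP: h1 => _ h1; case/andP: h2 => h2 _; exact: le_trans h2.
  have [r /= r0 hr] : nbhs s U by exact: open_nbhs_nbhs.
  exists r => // y y' uy y'v /andP[h1 h2] /andP[h3 h4] [l [la lp lm lx]].
  have yy' : y <= y' by exact: le_trans h3.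
  exists (rcons l (y, y')); split.
  - rewrite all_rcons /= uy yy' lexx /=.
    by apply: sub_all la => i /and3P[-> -> /=] /le_trans; exact.
  - rewrite pairwise_rcons lp andbT /=.
    by apply: sub_all la => i /and3P[].
  - rewrite big_rcons /=; apply: le_trans (madd _ _ uy yy' _).
      by rewrite lerD2r.
    move=> t; rewrite /= in_itv /= => /andP[yt ty']; apply: hr => /=.
    rewrite ltr_norml; lra.
  - rewrite big_rcons /=.
    have : - `|x y' - x y| <= x y' - x y by rewrite lerNl -normrN ler_norm.
    have : 0 <= e * (y' - y) by rewrite mulr_ge0 ?subr_ge0 // ltW.
    lra.
move=> [l [la lp lm lx]].
suff : \sum_(i <- l) `|x i.2 - x i.1| < e by lra.
rewrite (big_nth (0, 0)) big_mkord.
apply: (hd (size l) (fun i => (nth (0, 0) l i).1) (fun i => (nth (0, 0) l i).2)).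
- by move=> i; have /(all_nthP (0, 0)) /(_ i (ltn_ord i)) /and3P := la.
- move=> i j ij; have := neq_ltn i j; rewrite [i != j :> nat]ij => /esym /orP[] h.
    by left; apply: (pairwiseP (0, 0) lp) h; rewrite inE.
  by right; apply: (pairwiseP (0, 0) lp) h; rewrite inE.
- move: lm; rewrite (big_nth (0, 0)) big_mkord => /le_lt_trans; apply; exact: mle.
Qed.

End monotone.

(** * Locally Lipschitz functions *)

Section lipschitz.
Variable R : realType.
Local Notation mu := (@lebesgue_measure R).
Implicit Types (x y g : R -> R).

(** The balls are centred at 0, so that one constant serves each compact
interval and the product rule needs no continuity argument. *)
Definition locally_lipschitz x := forall A : R, exists2 L : R, 0 <= L &
  forall s t, `|s| <= A -> `|t| <= A -> `|x t - x s| <= L * `|t - s|.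

Lemma loclip_locally_bounded x : locally_lipschitz x ->
  forall A : R, exists2 M : R, 0 <= M & forall t, `|t| <= A -> `|x t| <= M.
Proof.
move=> lx A; have [L L0 hL] := lx A.
exists (`|x 0| + L * `|A|) => [|t tA]; first by rewrite addr_ge0 // mulr_ge0.
have A0 : 0 <= A by exact: le_trans tA.
have := hL 0 t; rewrite normr0 subr0 => /(_ A0 tA) h.
have h2 : L * `|t| <= L * `|A| by rewrite ler_wpM2l // (le_trans tA) ?ler_norm.
have := ler_normD (x t - x 0) (x 0); rewrite subrK; lra.
Qed.

Lemma loclip_cst (c : R) : locally_lipschitz (fun=> c).
Proof. by move=> A; exists 0 => // s t _ _; rewrite subrr normr0 mul0r. Qed.

Lemma loclip_id : locally_lipschitz id.
Proof. by move=> A; exists 1 => // s t _ _; rewrite mul1r. Qed.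

Lemma loclipD x y : locally_lipschitz x -> locally_lipschitz y ->
  locally_lipschitz (fun t => x t + y t).
Proof.
move=> lx ly A; have [L L0 hL] := lx A; have [K K0 hK] := ly A.
exists (L + K) => [|s t sA tA]; first exact: addr_ge0.
rewrite opprD addrACA (le_trans (ler_normD _ _)) // mulrDl.
by rewrite lerD // ?hL ?hK.
Qed.

Lemma loclipM x y : locally_lipschitz x -> locally_lipschitz y ->
  locally_lipschitz (fun t => x t * y t).
Proof.
move=> lx ly A; have [L L0 hL] := lx A; have [K K0 hK] := ly A.
have [M M0 hM] := loclip_locally_bounded lx A.
have [N N0 hN] := loclip_locally_bounded ly A.
exists (M * K + N * L) => [|s t sA tA]; first by rewrite addr_ge0 // mulr_ge0.
have -> : x t * y t - x s * y s = x t * (y t - y s) + y s * (x t - x s) by ring.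
rewrite (le_trans (ler_normD _ _)) // !normrM mulrDl -!mulrA.
by rewrite lerD // ler_pM ?hM ?hN ?hL ?hK.
Qed.

Lemma loclipZ (c : R) x : locally_lipschitz x -> locally_lipschitz (fun t => c * x t).
Proof. by apply: loclipM; exact: loclip_cst. Qed.

Lemma loclipN x : locally_lipschitz x -> locally_lipschitz (fun t => - x t).
Proof. by move=> /(loclipZ (-1)); under eq_fun do rewrite mulN1r. Qed.

Lemma loclipB x y : locally_lipschitz x -> locally_lipschitz y ->
  locally_lipschitz (fun t => x t - y t).
Proof. by move=> lx ly; apply: loclipD => //; exact: loclipN. Qed.

Lemma loclip_expR x : locally_lipschitz x -> locally_lipschitz (fun t => expR (x t)).
Proof.
move=> lx A; have [L L0 hL] := lx A.
have [M M0 hM] := loclip_locally_bounded lx A.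
exists (expR M * L) => [|s t sA tA]; first by rewrite mulr_ge0 // expR_ge0.
rewrite -mulrA (le_trans _ (ler_wpM2l (expR_ge0 M) (hL _ _ sA tA))) //.
have key a b : b <= a -> `|a| <= M -> `|expR a - expR b| <= expR M * `|a - b|.
  move=> ba aM; rewrite !ger0_norm ?subr_ge0 ?ler_expR //.
  have -> : expR a - expR b = expR a * (1 - expR (b - a)).
    by rewrite mulrBr mulr1 -expRD subrKC.
  apply: ler_pM; rewrite ?expR_ge0 ?subr_ge0 ?expR_le1 ?subr_le0 //.
    by rewrite ler_expR (le_trans (ler_norm _)).
  by have := expR_ge1Dx (b - a); lra.
have [xx|/ltW xx] := leP (x s) (x t); first by apply: key => //; exact: hM.
by rewrite distrC (distrC (x t)); apply: key => //; exact: hM.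
Qed.

Lemma loclipV x : (forall t, 1 <= x t) -> locally_lipschitz x ->
  locally_lipschitz (fun t => (x t)^-1).
Proof.
move=> x1 lx A; have [L L0 hL] := lx A; exists L => // s t sA tA.
have x0 r : 0 < x r by rewrite (lt_le_trans _ (x1 r)).
have -> : (x t)^-1 - (x s)^-1 = (x s - x t) * ((x t)^-1 * (x s)^-1).
  by field; rewrite !gt_eqF.
rewrite normrM distrC (le_trans _ (hL _ _ sA tA)) // ler_piMr //.
rewrite ger0_norm ?mulr_ge0 ?invr_ge0 ?(ltW (x0 _)) //.
by rewrite mulr_ile1 ?invr_ge0 ?(ltW (x0 _)) // invf_le1.
Qed.

Lemma loclip_opp x : locally_lipschitz x -> locally_lipschitz (fun t => x (- t)).
Proof.
move=> lx A; have [L L0 hL] := lx A; exists L => // s t sA tA.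
by rewrite (le_trans (hL _ _ _ _)) ?normrN // opprK -(normrN (t - s)) opprB addrC.
Qed.

Lemma loclip_continuous x : locally_lipschitz x -> continuous x.
Proof.
move=> lx s; have [L L0 hL] := lx (`|s| + 1).
apply/cvgrPdist_le => e e0.
have L1 : 0 < L + 1 by rewrite ltr_wpDl.
near=> t.
have ts : `|s - t| <= 1 by near: t; exact: cvgr_dist_le.
have : `|s - t| <= e / (L + 1).
  by near: t; apply: cvgr_dist_le => //; exact: divr_gt0.
rewrite ler_pdivlMr // => h.
rewrite (le_trans (hL _ _ _ _)) //.
- have := ler_normD s (t - s); rewrite subrKC distrC; lra.
- by rewrite lerDl.
- by rewrite mulrDr mulr1 in h; rewrite mulrC (le_trans _ h) // lerDl.
Unshelve. all: by end_near. Qed.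

Lemma loclip_ac x (u v : R) : locally_lipschitz x -> abs_continuous u v x.
Proof.
move=> lx e e0; have [L L0 hL] := lx (Num.max `|u| `|v|).
have L1 : 0 < L + 1 by rewrite ltr_wpDl.
exists (e / (L + 1)); first exact: divr_gt0.
move=> n c d cd _; rewrite ltr_pdivlMr // => h.
apply: le_lt_trans h; rewrite mulr_suml ler_sum // => i _.
have [uc cdi dv] := cd i.
have bnd r : u <= r -> r <= v -> `|r| <= Num.max `|u| `|v|.
  move=> ur rv; rewrite le_max; have [r0|r0] := leP 0 r.
    by rewrite [X in _ || X](_ : _ = true) ?orbT // !ger0_norm //; lra.
  by rewrite [X in X || _](_ : _ = true) // !ler0_norm //; lra.
rewrite (le_trans (hL _ _ _ _)) ?bnd ?(le_trans cdi) ?(le_trans uc) //.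
rewrite ger0_norm ?subr_ge0 // mulrC ler_wpM2l ?subr_ge0 //; lra.
Qed.

Lemma ac_addl x (u v L : R) : abs_continuous u v x ->
  abs_continuous u v (fun t => x t + L * t).
Proof.
move=> ax e e0; have e2 : 0 < e / 2 by lra.
have [d d0 hd] := ax _ e2.
have L1 : 0 < `|L| + 1 by rewrite ltr_wpDl.
exists (Num.min d (e / 2 / (`|L| + 1))).
  by rewrite lt_min d0 divr_gt0.
move=> n c d' cd dis; rewrite lt_min => /andP[/(hd _ _ _ cd dis) h1].
rewrite ltr_pdivlMr // => h2.
apply: (@le_lt_trans _ _ (\sum_(i < n) `|x (d' i) - x (c i)| +
   (\sum_(i < n) (d' i - c i)) * (`|L| + 1))); last by lra.
rewrite mulr_suml -big_split /= ler_sum // => i _.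
have [_ cdi _] := cd i.
have -> : x (d' i) + L * d' i - (x (c i) + L * c i) =
  (x (d' i) - x (c i)) + L * (d' i - c i) by ring.
rewrite (le_trans (ler_normD _ _)) // lerD2l normrM.
rewrite (ger0_norm (_ : 0 <= d' i - c i)) ?subr_ge0 // mulrC.
by rewrite ler_wpM2l ?subr_ge0 // lerDl.
Qed.

Lemma acN x (u v : R) : abs_continuous u v x -> abs_continuous u v (fun t => - x t).
Proof.
move=> ax e e0; have [d d0 hd] := ax _ e0; exists d => // n c d' cd dis h.
by under eq_bigr do rewrite -opprD normrN; exact: hd.
Qed.

Lemma aeS (P Q : R -> Prop) : (forall t, P t -> Q t) ->
  {ae mu, forall t, P t} -> {ae mu, forall t, Q t}.
Proof. by move=> PQ aP; apply: (@filterS _ _ (ae_filter_ringOfSetsType mu) P Q). Qed.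

Lemma aeS2 (P Q S : R -> Prop) : (forall t, P t -> Q t -> S t) ->
  {ae mu, forall t, P t} -> {ae mu, forall t, Q t} -> {ae mu, forall t, S t}.
Proof.
by move=> PQ aP aQ; apply: (@filterS2 _ _ (ae_filter_ringOfSetsType mu) P Q S).
Qed.

Lemma is_derive_lin (L t : R) : is_derive t 1 (fun s : R => L * s) L.
Proof. by have := @is_deriveZ _ _ _ id L t 1 1 _; rewrite [L *: 1]mulr1; apply. Qed.

Lemma is_derive_addf x y (t dx dy : R) : is_derive t 1 x dx -> is_derive t 1 y dy ->
  is_derive t 1 (fun s : R => x s + y s) (dx + dy).
Proof. exact: is_deriveD. Qed.

Lemma is_derive_oppf x (t dx : R) : is_derive t 1 x dx ->
  is_derive t 1 (fun s : R => - x s) (- dx).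
Proof. exact: is_deriveN. Qed.

Lemma is_derive_mulf x y (t dx dy : R) : is_derive t 1 x dx -> is_derive t 1 y dy ->
  is_derive t 1 (fun s : R => x s * y s) (dx * y t + x t * dy).
Proof.
move=> hx hy; have := @is_deriveM _ _ x y t 1 _ _ hx hy.
move=> /is_derive_eq; apply; by rewrite /GRing.scale /= addrC mulrC.
Qed.

Lemma is_derive_scalef (c : R) x (t dx : R) : is_derive t 1 x dx ->
  is_derive t 1 (fun s : R => c * x s) (c * dx).
Proof. exact: is_deriveZ. Qed.

Lemma is_derive_expRf x (t dx : R) : is_derive t 1 x dx ->
  is_derive t 1 (fun s : R => expR (x s)) (dx * expR (x t)).
Proof.
move=> hx; have := @is_derive1_comp _ expR x t _ _ (is_derive_expR _) hx.
by rewrite mulrC.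
Qed.

Lemma is_derive_invf x (t dx : R) : x t != 0 -> is_derive t 1 x dx ->
  is_derive t 1 (fun s : R => (x s)^-1) (- dx / x t ^+ 2).
Proof.
move=> x0 hx; have := is_deriveV x0 hx.
move=> /is_derive_eq; apply; by rewrite /GRing.scale /= mulrC mulrN mulNr.
Qed.

Lemma is_derive_reflect x (t dx : R) : is_derive (- t) 1 x dx ->
  is_derive t 1 (fun s : R => x (- s)) (- dx).
Proof.
move=> hx; have ht := is_derive_oppf (is_derive_id t 1).
have := @is_derive1_comp _ x (fun s => - s) t _ _ hx ht.
by rewrite mulrN1.
Qed.

(** Both L t + x and L t - x are absolutely continuous with nonnegative
derivative almost everywhere. *)
Lemma ac_ae_derive_bounded_loclip x (L : R) : 0 <= L ->
  (forall u v, u <= v -> abs_continuous u v x) ->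
  {ae mu, forall t : R, exists2 d : R, `|d| <= L & is_derive t 1 x d} ->
  locally_lipschitz x.
Proof.
move=> L0 ax dx; suff key s t : s <= t -> `|x t - x s| <= L * `|t - s|.
  move=> A; exists L => // s t _ _.
  have [|/ltW] := leP s t; first exact: key.
  by rewrite distrC (distrC t); exact: key.
move=> st.
have h1 : x s + L * s <= x t + L * t.
  apply: (ac_ae_derive_ge0 (x := fun t => x t + L * t) st).
    exact/ac_addl/ax.
  move: dx; apply: aeS => r [d dL xd] _; exists (d + L).
    by move: dL; rewrite ler_norml; lra.
  apply: (@is_deriveD _ _ _ x (fun t => L * t)).
  exact: is_derive_lin.
have h2 : - x s + L * s <= - x t + L * t.
  apply: (ac_ae_derive_ge0 (x := fun t => - x t + L * t) st).
    exact/ac_addl/acN/ax.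
  move: dx; apply: aeS => r [d dL xd] _; exists (- d + L).
    by move: dL; rewrite ler_norml; lra.
  apply: (@is_deriveD _ _ _ (fun t => - x t) (fun t => L * t)).
  exact: is_derive_lin.
by rewrite ler_norml ger0_norm ?subr_ge0 //; lra.
Qed.

Lemma loclip_ae_derive_ge0 x (u v : R) : u <= v -> locally_lipschitz x ->
  {ae mu, forall t : R, u < t < v -> exists2 d : R, 0 <= d & is_derive t 1 x d} ->
  x u <= x v.
Proof. by move=> uv lx; apply: ac_ae_derive_ge0 => //; exact: loclip_ac. Qed.

(** Lebesgue measure and its image under t |-> -t agree on half-open intervals,
hence everywhere. *)
Lemma ae_opp (P : R -> Prop) : {ae mu, forall t : R, P t} -> {ae mu, forall t, P (- t)}.
Proof.
move=> [A [mA A0 PA]].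
have mopp : measurable_fun [set: R] (-%R : R -> R) by exact: oppr_measurable.
exists (-%R @^-1` A); split.
- by rewrite -[X in measurable X]setTI; exact: mopp.
- rewrite -A0; apply/esym.
  pose opp : measurableTypeR R -> measurableTypeR R := -%R.
  unshelve refine (@lebesgue_measure_unique R (pushforward mu opp) _ A mA).
    exact: mopp.
  move=> X [[a b] _ <-]; rewrite /= /pushforward.
  have -> : -%R @^-1` `]a, b] = `[- b, - a[%classic.
    by apply/seteqP; split=> t /=; rewrite !in_itv /= => /andP[h1 h2];
       apply/andP; split; lra.
  rewrite !lebesgue_measure_itv /= !lte_fin ltrN2.
  by case: ifP => // _; rewrite -!EFinB opprK addrC.
- by move=> t nP; apply: PA.
Qed.

End lipschitz.

(** * Bounded measurable functions *)

Section bounded_measurable.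
Variable R : realType.
Local Notation mu := (@lebesgue_measure R).
Implicit Types (x y g : R -> R).

Definition bounded_measurable g :=
  measurable_fun [set: R] g /\ exists M : R, forall t, `|g t| <= M.

Lemma bm_cst (c : R) : bounded_measurable (fun=> c).
Proof. by split; [exact: measurable_cst|exists `|c|]. Qed.

Lemma bmD x y : bounded_measurable x -> bounded_measurable y ->
  bounded_measurable (fun t => x t + y t).
Proof.
move=> [mx [M hM]] [my [N hN]]; split; first exact: measurable_funD.
by exists (M + N) => t; rewrite (le_trans (ler_normD _ _)) // lerD.
Qed.

Lemma bmM x y : bounded_measurable x -> bounded_measurable y ->
  bounded_measurable (fun t => x t * y t).
Proof.
move=> [mx [M hM]] [my [N hN]]; split; first exact: measurable_funM.
by exists (M * N) => t; rewrite normrM ler_pM.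
Qed.

Lemma bmZ (c : R) x : bounded_measurable x -> bounded_measurable (fun t => c * x t).
Proof. by apply: bmM; exact: bm_cst. Qed.

Lemma bmN x : bounded_measurable x -> bounded_measurable (fun t => - x t).
Proof. by move=> /(bmZ (-1)); under eq_fun do rewrite mulN1r. Qed.

Lemma bmB x y : bounded_measurable x -> bounded_measurable y ->
  bounded_measurable (fun t => x t - y t).
Proof. by move=> bx by_; apply: bmD => //; exact: bmN. Qed.

Lemma bm_opp x : bounded_measurable x -> bounded_measurable (fun t => x (- t)).
Proof.
move=> [mx [M hM]]; split; last by exists M.
by apply: (measurableT_comp mx); exact: oppr_measurable.
Qed.

Lemma bm_sum n (x_ : 'I_n -> R -> R) : (forall i, bounded_measurable (x_ i)) ->
  bounded_measurable (fun t => \sum_(i < n) x_ i t).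
Proof.
elim: n x_ => [|n IH] x_ hx.
  by under eq_fun do rewrite big_ord0; exact: bm_cst.
under eq_fun do rewrite big_ord_recr /=.
by apply: bmD; [apply: IH => i|]; exact: hx.
Qed.

Lemma bounded_funE x : bounded_fun x <-> exists M : R, forall t, `|x t| <= M.
Proof.
split=> [[M [_ hM]]|[M hM]].
  exists (M + 1) => t; apply: (hM (M + 1)) => //; by rewrite ltrDl.
exists M; split; first exact: num_real.
by move=> N MN t _ /=; rewrite (le_trans (hM t)) // ltW.
Qed.

Lemma loclip_measurable x : locally_lipschitz x -> measurable_fun [set: R] x.
Proof. by move=> /loclip_continuous; exact: continuous_measurable_fun. Qed.

(** A right-continuous function is the pointwise limit of step functions: on
each cell [k / n, (k + 1) / n[ take the value at the right end of the cell. *)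
Lemma right_continuous_measurable x : right_continuous x -> measurable_fun [set: R] x.
Proof.
move=> rx.
pose r (n : nat) (t : R) : R := (Num.floor (n.+1%:R * t) + 1)%:~R / n.+1%:R.
have n0 (n : nat) : 0 < n.+1%:R :> R by rewrite ltr0n.
have rgt n t : t < r n t.
  by rewrite ltr_pdivlMr // mulrC floorD1_gt.
have rle n t : r n t <= t + n.+1%:R^-1.
  rewrite ler_pdivrMr // mulrDl mulVf ?gt_eqF // intrD mulrC (mulrC t) lerD2r.
  exact: Num.Theory.floor_le.
apply: (@measurable_fun_cvg _ _ _ _ (fun n t => x (r n t))).
  move=> n _ Y mY; rewrite setTI.
  rewrite [X in measurable X](_ : _ =
    \bigcup_(k : int) [set t | Num.floor (n.+1%:R * t) = k /\
      Y (x ((k + 1)%:~R / n.+1%:R))]); last first.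
    apply/seteqP; split=> t /=; first by exists (Num.floor (n.+1%:R * t)).
    by move=> [k _ [<-]].
  apply: countable_bigcupT_measurable => // k.
  have [Yk|nYk] := pselect (Y (x ((k + 1)%:~R / n.+1%:R))); last first.
    by rewrite (_ : [set t | _] = set0) //; apply/seteqP; split=> t // [].
  rewrite (_ : [set t | _] = `[k%:~R / n.+1%:R, (k + 1)%:~R / n.+1%:R[%classic) //.
  apply/seteqP; split=> t /=; rewrite in_itv /= ler_pdivrMr // ltr_pdivlMr //.
    by move=> [<- _]; rewrite mulrC Num.Theory.floor_le floorD1_gt.
  by rewrite (mulrC t) => h; split=> //; exact: floor_def.
move=> t _.
have rt : r n t @[n --> \oo] --> t^'+.
  move=> A [e /= e0 hA].
  suff : \forall n \near \oo, A (r n t) by [].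
  near=> n; apply: (hA (r n t) _ (rgt n t)).
  rewrite /ball_ /= distrC gtr0_norm ?subr_gt0 //.
  apply: le_lt_trans (_ : n.+1%:R^-1 < e); first by rewrite lerBlDl rle.
  by near: n; exact: near_infty_natSinv_lt (PosNum e0).
exact: cvg_comp rt (rx t).
Unshelve. all: by end_near. Qed.

Lemma BPUC_bounded_measurable x : BPUC x -> bounded_measurable x.
Proof.
move=> [n [a [x_ [hx xE]]]]; rewrite (_ : x = fun t => \sum_(i < n.+1) x_ i t).
  apply: bm_sum => i; have [_ [bx rx _]] := hx i; split.
    exact: right_continuous_measurable.
  exact/bounded_funE.
by apply/funext.
Qed.

End bounded_measurable.

(** * The bounded solution of a linear equation *)

Section relaxation.
Variable R : realType.
Local Notation mu := (@lebesgue_measure R).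
Implicit Types (x y g h : R -> R) (K : R).

(** Boundedness is asked on left half-lines only, because the integral defining
[relax] looks to the left, and because [attractive_perturbation] applies it to
a function that may grow at +oo. *)
Definition left_bounded g := measurable_fun [set: R] g /\
  forall A : R, exists M : R, forall t, t <= A -> `|g t| <= M.

Lemma bm_left_bounded g : bounded_measurable g -> left_bounded g.
Proof. by move=> [mg [M hM]]; split=> // A; exists M => t _. Qed.

Lemma integral_expR_Ny K (A : R) : 0 < K ->
  (\int[mu]_(s in `]-oo, A]) (expR (K * s))%:E = (expR (K * A) / K)%:E)%E.
Proof.
move=> K0.
have lin (c : R) : locally_lipschitz (fun s : R => expR (c * s)).
  by apply: loclip_expR; apply: loclipZ; exact: loclip_id.
rewrite -[A in LHS]opprK ge0_integration_by_substitutionNy; last 2 first.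
- by apply: continuous_subspaceT; exact/loclip_continuous.
- by move=> s _; exact: expR_ge0.
have dF (t : R) : is_derive t 1 (fun s : R => - K^-1 * expR (- K * s)) (expR (- K * t)).
  have -> : expR (- K * t) = - K^-1 * (- K * expR (- K * t)).
    by rewrite mulrA mulrNN mulVf ?mul1r // gt_eqF.
  apply: (@is_deriveZ _ _ _ (fun s : R => expR (- K * s)) (- K^-1) t 1).
  exact: is_derive_expRf (is_derive_lin (- K) t).
under eq_integral do rewrite /= mulrN -mulNr.
rewrite (@ge0_continuous_FTC2y _ (fun s => expR (- K * s))
  (fun s => - K^-1 * expR (- K * s)) _ 0).
- by rewrite sub0e -EFinN !mulNr opprK mulrN opprK mulrC.
- by move=> s _; exact: expR_ge0.
- by apply: continuous_subspaceT; exact/loclip_continuous.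
- rewrite -[X in _ --> X](mulr0 (- K^-1)); apply: cvgMr => /=.
  under eq_fun do rewrite mulNr.
  apply: (cvg_comp _ _ _ (@cvgr_expR R)).
  apply: gt0_cvgMry => //; exact: cvg_id.
- by move=> s _; have [] := dF s.
- apply: cvg_at_right_filter.
  exact: (loclip_continuous (loclipZ (- K^-1) (lin (- K)))).
- move=> s _; rewrite derive1E; have [_ ->] := dF s.
  by rewrite mulNr.
Qed.

Lemma integrable_expR_Ny K (A : R) : 0 < K ->
  mu.-integrable `]-oo, A] (EFin \o (fun s => expR (K * s))).
Proof.
move=> K0; apply/integrableP; split.
  apply/measurable_EFinP; apply: measurable_funTS; apply: loclip_measurable.
  by apply: loclip_expR; apply: loclipZ; exact: loclip_id.
under eq_integral do rewrite /= ger0_norm ?expR_ge0 //.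
by rewrite integral_expR_Ny // ltry.
Qed.

Lemma measurable_expM K g : measurable_fun [set: R] g ->
  measurable_fun [set: R] (fun s => expR (K * s) * g s).
Proof.
move=> mg; apply: measurable_funM => //; apply: loclip_measurable.
by apply: loclip_expR; apply: loclipZ; exact: loclip_id.
Qed.

Lemma integrable_exp_left_bounded K g (A : R) : 0 < K -> left_bounded g ->
  mu.-integrable `]-oo, A] (EFin \o (fun s => expR (K * s) * g s)).
Proof.
move=> K0 [mg bg]; have [M hM] := bg A.
apply: (@le_integrable _ _ _ mu `]-oo, A] _ _
  (EFin \o (fun s => expR (K * s) * M))) => //.
- by apply/measurable_EFinP; apply: measurable_funTS; exact: measurable_expM.
- move=> s /=; rewrite in_itv /= => sA; rewrite lee_fin !normrM.
  by rewrite ler_wpM2l // (le_trans (hM _ sA)) // ler_norm.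
- rewrite (_ : _ \o _ = fun s => ((expR (K * s))%:E * M%:E)%E) //.
  by apply: integrableZr => //; exact: integrable_expR_Ny.
Qed.

(** The bounded solution of r' + K r = g on the whole line. *)
Definition relax K g (t : R) : R :=
  expR (- (K * t)) * \int[mu]_(s in `]-oo, t]) (expR (K * s) * g s).

Lemma relax_le K g h t : 0 < K -> left_bounded g -> left_bounded h ->
  (forall s, s <= t -> g s <= h s) -> relax K g t <= relax K h t.
Proof.
move=> K0 lg lh gh; rewrite ler_wpM2l ?expR_ge0 //; apply: le_Rintegral => //.
- exact: integrable_exp_left_bounded.
- exact: integrable_exp_left_bounded.
- by move=> s /=; rewrite in_itv /= => st; rewrite ler_wpM2l ?expR_ge0 ?gh.
Qed.

Lemma relaxD K g h t : 0 < K -> left_bounded g -> left_bounded h ->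
  relax K (fun s => g s + h s) t = relax K g t + relax K h t.
Proof.
move=> K0 lg lh; rewrite /relax -mulrDr -RintegralD //; last 2 first.
- exact: integrable_exp_left_bounded.
- exact: integrable_exp_left_bounded.
by congr (_ * _); apply: eq_Rintegral => s _; rewrite mulrDr.
Qed.

Lemma relaxZ K (c : R) g t : 0 < K -> left_bounded g ->
  relax K (fun s => c * g s) t = c * relax K g t.
Proof.
move=> K0 lg; rewrite /relax [RHS]mulrCA -[in RHS]RintegralZl //; last first.
  exact: integrable_exp_left_bounded.
by congr (_ * _); apply: eq_Rintegral => s _; rewrite mulrCA.
Qed.

Lemma relaxB K g h t : 0 < K -> left_bounded g -> left_bounded h ->
  relax K (fun s => g s - h s) t = relax K g t - relax K h t.
Proof.
move=> K0 lg lh; rewrite -mulN1r -relaxZ // -relaxD //.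
  by congr relax; apply/funext => s; rewrite mulN1r.
case: lh => mh bh; split; first exact: measurable_funM.
move=> A; have [M hM] := bh A; exists M => s sA.
by rewrite mulN1r normrN hM.
Qed.

Lemma relax_cst K (c : R) t : 0 < K -> relax K (fun=> c) t = c / K.
Proof.
move=> K0; rewrite -[X in fun=> X]mulr1 relaxZ //; last first.
  exact/bm_left_bounded/bm_cst.
congr (_ * _); rewrite /relax.
under eq_Rintegral do rewrite mulr1.
rewrite /Rintegral integral_expR_Ny //= mulrA -expRD addNr expR0.
by rewrite mul1r.
Qed.

Lemma relax_primitiveB K g (s t : R) : 0 < K -> left_bounded g -> s <= t ->
  \int[mu]_(r in `]-oo, t]) (expR (K * r) * g r) -
  \int[mu]_(r in `]-oo, s]) (expR (K * r) * g r) =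
  \int[mu]_(r in `]s, t]) (expR (K * r) * g r).
Proof.
move=> K0 lg st; rewrite Rintegral_itvB //.
exact: integrable_exp_left_bounded.
Qed.

(** The weight exp (K s) is positive, so that a gap c on ]-oo, u] keeps
contributing at every later time t. *)
Lemma relax_lt K g h (u t c : R) : 0 < K -> left_bounded g -> left_bounded h ->
  (forall s, s <= t -> g s <= h s) -> u <= t -> 0 < c ->
  (forall s, s <= u -> g s + c <= h s) -> relax K g t < relax K h t.
Proof.
move=> K0 lg lh gh ut c0 gch.
have lgc : left_bounded (fun s => g s + c).
  case: lg => mg bg; split; first exact: measurable_funD.
  move=> A; have [M hM] := bg A; exists (M + `|c|) => s sA.
  by rewrite (le_trans (ler_normD _ _)) // lerD2r hM.
have := relax_le K0 lgc lh gch.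
rewrite relaxD ?relax_cst //; last exact/bm_left_bounded/bm_cst.
rewrite /relax => H; rewrite ltr_pM2l ?expR_gt0 //.
have e := relax_primitiveB K0 lg ut; have e' := relax_primitiveB K0 lh ut.
have sub f : left_bounded f ->
    mu.-integrable `]u, t] (EFin \o (fun r => expR (K * r) * f r)).
  move=> lf; apply: (@integrableS _ _ _ mu `]-oo, t]) => //.
    by move=> r /=; rewrite !in_itv /= => /andP[].
  exact: integrable_exp_left_bounded.
have : \int[mu]_(r in `]u, t]) (expR (K * r) * g r) <=
       \int[mu]_(r in `]u, t]) (expR (K * r) * h r).
  apply: le_Rintegral => //; try exact: sub.
  move=> r /=; rewrite in_itv /= => /andP[_ rt].
  by rewrite ler_wpM2l ?expR_ge0 ?gh.
suff : \int[mu]_(r in `]-oo, u]) (expR (K * r) * g r) <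
       \int[mu]_(r in `]-oo, u]) (expR (K * r) * h r) by lra.
rewrite -(ltr_pM2l (expR_gt0 (- (K * u)))); apply: lt_le_trans H.
by rewrite ltrDl divr_gt0.
Qed.

Lemma relax_loclip K g : 0 < K -> left_bounded g -> locally_lipschitz (relax K g).
Proof.
move=> K0 lg; apply: loclipM.
  by apply: loclip_expR; apply: loclipN; apply: loclipZ; exact: loclip_id.
move=> A; have [M hM] := lg.2 A.
have M0 t : t <= A -> 0 <= M by move=> /hM; exact: le_trans.
exists (expR (K * A) * `|M|); first by rewrite mulr_ge0 // expR_ge0.
suff key (s t : R) : `|s| <= A -> `|t| <= A -> s <= t ->
  `|\int[mu]_(r in `]-oo, t]) (expR (K * r) * g r) -
    \int[mu]_(r in `]-oo, s]) (expR (K * r) * g r)| <= expR (K * A) * `|M| * `|t - s|.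
  move=> s t sA tA; have [|/ltW] := leP s t; first exact: key.
  by rewrite distrC (distrC t); exact: key.
move=> sA tA st; rewrite relax_primitiveB //.
have it : mu.-integrable `]s, t] (EFin \o (fun r => expR (K * r) * g r)).
  apply: (@integrableS _ _ _ mu `]-oo, t]) => //.
    by move=> r /=; rewrite !in_itv /= => /andP[].
  exact: integrable_exp_left_bounded.
rewrite (le_trans (le_normr_Rintegral _ it)) //.
have muE : fine (mu `]s, t]) = `|t - s|.
  rewrite lebesgue_measure_itv /= lte_fin ger0_norm ?subr_ge0 //.
  by case: ltgtP st => // -> _; rewrite subrr.
rewrite -muE -Rintegral_cst //; apply: le_Rintegral => //.
- exact: integrable_norm it.
- apply/integrableP; split; first exact: measurable_cst.
  rewrite integral_cst // lte_mul_pinfty ?lee_fin //.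
  rewrite -[X in (X < _)%E]/(mu `]s, t]) lebesgue_measure_itv /=.
  by case: ifP => // _; rewrite -EFinB ltry.
- move=> r /=; rewrite in_itv /= => /andP[_ rt].
  have rA : r <= A by rewrite (le_trans rt) // (le_trans (ler_norm _)).
  rewrite normrM ler_pM // ?(le_trans (hM _ rA)) ?ler_norm //.
  by rewrite ger0_norm ?expR_ge0 // ler_expR ler_wpM2l // ltW.
Qed.

(** Lebesgue's differentiation theorem for the integral, and the product rule
for the factor exp (- K t). *)
Lemma relax_ae_derive K g : 0 < K -> left_bounded g ->
  {ae mu, forall t : R, is_derive t 1 (relax K g) (g t - K * relax K g t)}.
Proof.
move=> K0 lg; have mg := measurable_expM K lg.1.
have loc : locally_integrable [set: R] (fun s => expR (K * s) * g s).
  split; [exact: mg|exact: openT|].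
  move=> C _ cC; have /compact_bounded[M [_ hM]] := cC.
  have CM : C `<=` `]-oo, (M + 1)].
    move=> s /(hM (M + 1)); rewrite ltrDl ltr01 /= in_itv /= => /(_ isT).
    by apply: le_trans; exact: ler_norm.
  have /integrableP[_] := integrable_exp_left_bounded (M + 1) K0 lg.
  apply: le_lt_trans; apply: ge0_subset_integral => //.
    exact: compact_measurable.
  apply/measurable_EFinP; apply: measurable_funTS.
  exact: measurableT_comp.
have /= H := FTC1Ny (fun A => integrable_exp_left_bounded A K0 lg) loc.
move: H; apply: (@aeS R) => t [dx Dx].
set Q := fun t : R => \int[mu]_(s in `]-oo, t]) (expR (K * s) * g s).
have dQ : is_derive t 1 Q (expR (K * t) * g t).
  by split; rewrite -?derive1E.
have dE := is_derive_expRf (is_derive_oppf (is_derive_lin K t)).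
have := is_derive_mulf dE dQ.
move=> /is_derive_eq; apply; rewrite /relax -/(Q t) [X in _ + X]mulrA -expRD addNr expR0.
by rewrite mul1r; ring.
Qed.

(** Dominated convergence with dominating function M exp (K s). *)
Lemma relax_cvg K (g_ : nat -> R -> R) g (M t : R) : 0 < K ->
  (forall n, measurable_fun [set: R] (g_ n)) ->
  (forall n s, `|g_ n s| <= M) ->
  (forall s, g_ n s @[n --> \oo] --> g s) ->
  relax K (g_ n) t @[n --> \oo] --> relax K g t.
Proof.
move=> K0 mg hM gg; apply: cvgMr.
have mgl : measurable_fun [set: R] g.
  by apply: (measurable_fun_cvg (h := g_)) => // s _; exact: gg.
pose F n : R -> \bar R := EFin \o (fun s => expR (K * s) * g_ n s).
have [//||||||ig _ cv] := @dominated_convergence _ _ _ mu `]-oo, t] _ F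
   (EFin \o (fun s => expR (K * s) * g s))
   (EFin \o (fun s => expR (K * s) * M)).
- by move=> n; apply/measurable_EFinP; apply: measurable_funTS; exact: measurable_expM.
- by apply/measurable_EFinP; apply: measurable_funTS; exact: measurable_expM.
- apply: aeW => s _ /=; apply: cvg_EFin; last by apply: cvgMr; exact: gg.
  by apply: nearW.
- apply: (integrable_exp_left_bounded (g := fun=> M)) => //.
  exact/bm_left_bounded/bm_cst.
- apply: aeW => s n _ /=; rewrite lee_fin normrM ger0_norm ?expR_ge0 //.
  by rewrite ler_wpM2l ?expR_ge0.
rewrite -(fineK (integrable_fin_num _ ig)) // in cv.
by have /fine_cvgP[_] := cv.
Qed.

End relaxation.

(** * Bounded solutions as fixed points *)

Section riccati.
Variable R : realType.
Local Notation mu := (@lebesgue_measure R).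
Implicit Types (x y z g G p : R -> R) (K l : R).

Lemma relax_bounded_measurable K g : 0 < K -> bounded_measurable g ->
  bounded_measurable (relax K g).
Proof.
move=> K0 bg; have lg := bm_left_bounded bg; have [_ [M hM]] := bg; split.
  exact: loclip_measurable (relax_loclip K0 lg).
have lc c := bm_left_bounded (bm_cst c).
exists (M / K) => t; rewrite ler_norml -mulNr -!(relax_cst _ t K0).
by apply/andP; split; apply: relax_le => // s _; have := hM s;
  rewrite ler_norml => /andP[].
Qed.

(** The function exp (K t) (relax K g t - x t) has a nonnegative derivative and
tends to 0 at -oo, because x and relax K g are bounded. *)
Lemma le_relax_of_ae_derive K x g : 0 < K -> bounded_measurable g ->
  locally_lipschitz x -> (exists M : R, forall t, `|x t| <= M) ->
  {ae mu, forall t : R, exists2 d : R, is_derive t 1 x d & d + K * x t <= g t} ->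
  forall t, x t <= relax K g t.
Proof.
move=> K0 bg lx [M hM] dx t.
have [_ [M' hM']] := relax_bounded_measurable K0 bg.
pose w s := expR (K * s) * (relax K g s - x s).
have lw : locally_lipschitz w.
  apply: loclipM; first by apply/loclip_expR/loclipZ; exact: loclip_id.
  by apply: loclipB => //; apply: relax_loclip => //; exact: bm_left_bounded.
have wmono s : s <= t -> w s <= w t.
  move=> st; apply: (loclip_ae_derive_ge0 st lw).
  apply: aeS2 dx (relax_ae_derive K0 (bm_left_bounded bg)) => r [d xd dg] rd _.
  have := is_derive_mulf (is_derive_expRf (is_derive_lin K r))
    (is_derive_addf rd (is_derive_oppf xd)).
  set D := (X in is_derive _ _ _ X) => hD; exists D; last exact: hD.
  have -> : D = expR (K * r) * (g r - (d + K * x r)) by rewrite /D; ring.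
  by rewrite mulr_ge0 ?expR_ge0 // subr_ge0.
rewrite leNgt; apply/negP => lt.
have w0 : 0 < - w t by rewrite oppr_gt0 pmulr_rlt0 ?expR_gt0 // subr_lt0.
pose C := M + M'.
have C0 : 0 <= C.
  exact: addr_ge0 (le_trans (normr_ge0 _) (hM 0)) (le_trans (normr_ge0 _) (hM' 0)).
have C1 : 0 < C + 1 by lra.
have q0 : 0 < - w t / (C + 1) by exact: divr_gt0.
(* Far enough to the left for w s to exceed w t < 0. *)
pose s := Num.min t (ln (- w t / (C + 1)) / K).
have st : s <= t by rewrite ge_min lexx.
have es : expR (K * s) <= - w t / (C + 1).
  rewrite -[leRHS]lnK ?posrE // ler_expR mulrC -ler_pdivlMr //.
  by rewrite ge_min lexx orbT.
have h1 : - (expR (K * s) * C) <= w s.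
  rewrite -mulrN ler_wpM2l ?expR_ge0 //.
  have := hM s; have := hM' s; rewrite !ler_norml /C; lra.
have h2 : expR (K * s) * C <= - w t / (C + 1) * C by rewrite ler_wpM2r.
have h3 : - w t / (C + 1) * C < - w t.
  rewrite mulrAC ltr_pdivrMr // ltr_pM2l //; lra.
have := wmono _ st; lra.
Qed.

(** Its fixed points are the bounded solutions, for every K > 0. The term K y
is added on both sides of the equation to make the operator monotone. *)
Definition relaxation_step K G p l y : R -> R :=
  relax K (fun s => shifted_riccati G p l s (y s) + K * y s).

(** The integrated form of z' <= f(t, z). It does not mention a derivative of z,
so that y - D is a subsolution when D is only monotone. *)
Definition subsolution G p l z := bounded_measurable z /\
  forall K, 0 < K -> forall t, z t <= relaxation_step K G p l z t.

Lemma bm_shifted_riccati G p l y : bounded_measurable G -> bounded_measurable p ->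
  bounded_measurable y -> bounded_measurable (fun s => shifted_riccati G p l s (y s)).
Proof.
move=> bG bp by_; apply: bmD; last exact: bm_cst.
apply: bmD => //; apply: bmN; rewrite (_ : (fun _ => _) =
  fun t => (y t - G t) * (y t - G t)); last by apply/funext => t; rewrite expr2.
by apply: bmM; exact: bmB.
Qed.

Lemma bm_step_arg K G p l y : bounded_measurable G -> bounded_measurable p ->
  bounded_measurable y ->
  bounded_measurable (fun s => shifted_riccati G p l s (y s) + K * y s).
Proof. by move=> bG bp by_; apply: bmD; [exact: bm_shifted_riccati|exact: bmZ]. Qed.

Lemma bm_step K G p l y : 0 < K -> bounded_measurable G -> bounded_measurable p ->
  bounded_measurable y -> bounded_measurable (relaxation_step K G p l y).
Proof. by move=> *; apply: relax_bounded_measurable => //; exact: bm_step_arg. Qed.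

Lemma fixpoint_bounded_solution K G p l y : 0 < K ->
  bounded_measurable G -> bounded_measurable p -> bounded_measurable y ->
  (forall t, y t = relaxation_step K G p l y t) ->
  bounded_solution (shifted_riccati G p l) y.
Proof.
move=> K0 bG bp by_ yE; have /bm_left_bounded la := bm_step_arg K l bG bp by_.
have yE' : y = relaxation_step K G p l y by exact/funext.
split; last by apply/bounded_funE; case: by_.
split; first by move=> u v _; rewrite yE'; exact/loclip_ac/relax_loclip.
have := relax_ae_derive K0 la; apply: aeS => t.
by rewrite -/(relaxation_step K G p l y) -yE' addrK.
Qed.

(** The right-hand side is bounded along a bounded solution. *)
Lemma bounded_solution_loclip G p l y : bounded_measurable G -> bounded_measurable p ->
  bounded_solution (shifted_riccati G p l) y ->
  locally_lipschitz y /\ bounded_measurable y.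
Proof.
move=> [_ [B hB]] [_ [C hC]] [[acy dy] /bounded_funE[M hM]].
have ly : locally_lipschitz y.
  apply: (@ac_ae_derive_bounded_loclip _ _ ((M + B) ^+ 2 + C + `|l|)) => //.
    exact: addr_ge0 (addr_ge0 (sqr_ge0 _) (le_trans (normr_ge0 _) (hC 0))) _.
  move: dy; apply: aeS => t dt; exists (shifted_riccati G p l t (y t)) => //.
  rewrite /shifted_riccati (le_trans (ler_normD _ _)) // lerD2r.
  rewrite (le_trans (ler_normD _ _)) // lerD // normrN normrX lerXn2r ?nnegrE //.
    exact: addr_ge0 (le_trans (normr_ge0 _) (hM 0)) (le_trans (normr_ge0 _) (hB 0)).
  by rewrite (le_trans (ler_normB _ _)) // lerD.
by split=> //; split; [exact: loclip_measurable|exists M].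
Qed.

Lemma ae_derive_subsolution G p l x : bounded_measurable G -> bounded_measurable p ->
  locally_lipschitz x -> (exists M : R, forall t, `|x t| <= M) ->
  {ae mu, forall t : R, exists2 d : R, is_derive t 1 x d &
     d <= shifted_riccati G p l t (x t)} ->
  subsolution G p l x.
Proof.
move=> bG bp lx bx dx; have bmx : bounded_measurable x.
  by split=> //; exact: loclip_measurable.
split=> // K K0; apply: le_relax_of_ae_derive => //; first exact: bm_step_arg.
by move: dx; apply: aeS => t [d xd df]; exists d => //; rewrite lerD2r.
Qed.

(** Both y and -y satisfy the differential inequality of
[le_relax_of_ae_derive]. *)
Lemma bounded_solution_fixpoint G p l y : bounded_measurable G -> bounded_measurable p ->
  bounded_solution (shifted_riccati G p l) y ->
  forall K, 0 < K -> forall t, y t = relaxation_step K G p l y t.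
Proof.
move=> bG bp sy K K0 t; have [ly bmy] := bounded_solution_loclip bG bp sy.
have [_ [M hM]] := bmy; have [[_ dy] _] := sy.
have ba := bm_step_arg K l bG bp bmy.
apply/eqP; rewrite eq_le; apply/andP; split.
  apply: le_relax_of_ae_derive => //; first by exists M.
  by move: dy; apply: aeS => s ds; exists (shifted_riccati G p l s (y s)).
rewrite -[leRHS]opprK lerNr /relaxation_step -[leRHS]mulN1r.
rewrite -relaxZ //; last exact: bm_left_bounded.
apply: (le_relax_of_ae_derive (x := fun s => - y s)) => //.
- exact: bmZ.
- exact: loclipN.
- by exists M => s; rewrite normrN.
- move: dy; apply: aeS => s ds; exists (- shifted_riccati G p l s (y s)).
    exact: is_derive_oppf.
  by move: (shifted_riccati _ _ _ _ _) => a; lra.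
Qed.

Lemma bounded_solution_subsolution G p l y : bounded_measurable G ->
  bounded_measurable p -> bounded_solution (shifted_riccati G p l) y ->
  subsolution G p l y.
Proof.
move=> bG bp sy; have [_ bmy] := bounded_solution_loclip bG bp sy.
split=> // K K0 t; rewrite -(bounded_solution_fixpoint bG bp sy K0); exact: lexx.
Qed.

(** The difference of the two sides is (b - a) (K - (a + b) + 2 G). *)
Lemma shifted_riccati_mono G p l (B S K s a b : R) : (forall t, `|G t| <= B) ->
  2 * (S + B) <= K -> a <= b -> b <= S ->
  shifted_riccati G p l s a + K * a <= shifted_riccati G p l s b + K * b.
Proof.
move=> hB hK ab bS; rewrite -subr_ge0 /shifted_riccati.
have -> : - (b - G s) ^+ 2 + p s + l + K * b - (- (a - G s) ^+ 2 + p s + l + K * a)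
  = (b - a) * (K - (a + b) + 2 * G s) by ring.
rewrite mulr_ge0 ?subr_ge0 //.
have := hB s; rewrite ler_norml; lra.
Qed.

Lemma relaxation_step_mono G p l (B S K : R) y z : 0 < K ->
  bounded_measurable G -> bounded_measurable p ->
  bounded_measurable y -> bounded_measurable z ->
  (forall t, `|G t| <= B) -> 2 * (S + B) <= K ->
  (forall s, y s <= z s) -> (forall s, z s <= S) ->
  forall t, relaxation_step K G p l y t <= relaxation_step K G p l z t.
Proof.
move=> K0 bG bp by_ bz hB hK yz zS t; apply: relax_le => //.
- exact/bm_left_bounded/bm_step_arg.
- exact/bm_left_bounded/bm_step_arg.
- by move=> s _; exact: (shifted_riccati_mono p l s hB hK (yz s) (zS s)).
Qed.

Lemma shifted_riccati_le G p l (B C S s : R) : (forall t, `|G t| <= B) ->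
  (forall t, `|p t| + `|l| <= C) -> B <= S ->
  shifted_riccati G p l s S <= - (S - B) ^+ 2 + C.
Proof.
move=> hB hC BS; rewrite /shifted_riccati -addrA; apply: lerD; last first.
  apply: le_trans (hC s); exact: lerD (ler_norm _) (ler_norm _).
rewrite lerN2 ler_sqr ?nnegrE ?subr_ge0 ?lerD2l ?lerN2 //.
  by rewrite (le_trans (ler_norm _)).
by rewrite (le_trans (ler_norm _)) // (le_trans (hB s)).
Qed.

(** If the supremum S of z were larger than this bound, the right-hand side at
the constant S would be at most -eta < 0, and one application of the operator
would give z <= S - eta / K. *)
Lemma subsolution_le G p l (B C : R) z : bounded_measurable G -> bounded_measurable p ->
  (forall t, `|G t| <= B) -> (forall t, `|p t| + `|l| <= C) ->
  subsolution G p l z -> forall t, z t <= B + C + 1.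
Proof.
move=> bG bp hB hC [bz hz] t0.
have B0 : 0 <= B by exact: le_trans (hB 0).
have C0 : 0 <= C by apply: le_trans (hC 0); rewrite addr_ge0.
have [_ [M hM]] := bz.
have hs : has_sup (range z).
  split; first by exists (z 0), 0.
  by exists M => _ [t _ <-]; rewrite (le_trans (ler_norm _)).
have zS t : z t <= sup (range z) by apply: ub_le_sup; [exact: hs.2|exists t].
apply: le_trans (zS t0) _; rewrite leNgt; apply/negP => lt.
set S := sup (range z) in zS lt *.
pose eta := (S - B) ^+ 2 - C.
have eta0 : 0 < eta.
  have : (C + 1) ^+ 2 <= (S - B) ^+ 2 by rewrite ler_sqr ?nnegrE; lra.
  rewrite sqrrD1 /eta; have := sqr_ge0 C; lra.
pose K := 2 * (S + B) + 1.
have K0 : 0 < K by rewrite /K; lra.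
have : S <= S - eta / K.
  apply: ge_sup; first exact: hs.1.
  move=> _ [t _ <-]; apply: le_trans (hz K K0 t) _.
  have -> : S - eta / K = (- eta + K * S) / K by field; rewrite gt_eqF.
  rewrite -(relax_cst _ t K0); apply: relax_le => //.
  - exact/bm_left_bounded/bm_step_arg.
  - exact/bm_left_bounded/bm_cst.
  - move=> s _.
    have h1 : 2 * (S + B) <= K by rewrite /K; lra.
    apply: le_trans (shifted_riccati_mono p l s hB h1 (zS s) (lexx _)) _.
    rewrite lerD2r /eta opprB addrC; apply: shifted_riccati_le => //; lra.
have : 0 < eta / K by exact: divr_gt0.
lra.
Qed.

(** The parameters vary with n, since the lemma serves both the construction of
solutions for a fixed parameter and the passage to the infimum of the
parameters. *)
Lemma relaxation_step_limit G p l K (l_ : nat -> R) (y_ w_ : nat -> R -> R) y (M L : R) :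
  0 < K -> bounded_measurable G -> bounded_measurable p ->
  (forall n, measurable_fun [set: R] (w_ n)) ->
  (forall n t, `|w_ n t| <= M) -> (forall n, `|l_ n| <= L) ->
  l_ n @[n --> \oo] --> l ->
  (forall t, y_ n t @[n --> \oo] --> y t) ->
  (forall t, w_ n t @[n --> \oo] --> y t) ->
  (forall n t, y_ n t = relaxation_step K G p (l_ n) (w_ n) t) ->
  forall t, y t = relaxation_step K G p l y t.
Proof.
move=> K0 bG bp mw hM hL ll yy wy yE t.
have [_ [B hB]] := bG; have [_ [P hP]] := bp.
have bw n : bounded_measurable (w_ n) by split=> //; exists M.
apply: (@cvg_unique _ (@Rhausdorff R) (y_ n t @[n --> \oo])); first exact: yy.
rewrite (_ : (fun n => y_ n t) = fun n => relaxation_step K G p (l_ n) (w_ n) t);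
  last by apply/funext.
apply: (relax_cvg (M := (M + B) ^+ 2 + P + L + K * M)) => //.
- by move=> n; have [] := bm_step_arg K (l_ n) bG bp (bw n).
- move=> n s; rewrite (le_trans (ler_normD _ _)) // lerD //; last first.
    by rewrite normrM (gtr0_norm K0) ler_wpM2l // ltW.
  rewrite /shifted_riccati (le_trans (ler_normD _ _)) // lerD //.
  rewrite (le_trans (ler_normD _ _)) // lerD // normrN normrX lerXn2r ?nnegrE //.
    exact: addr_ge0 (le_trans (normr_ge0 _) (hM 0 0)) (le_trans (normr_ge0 _) (hB 0)).
  by rewrite (le_trans (ler_normB _ _)) // lerD.
- move=> s; rewrite /shifted_riccati; apply: cvgD; last by apply: cvgMr; exact: wy.
  apply: cvgD => //; apply: cvgD; last exact: cvg_cst.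
  apply: cvgN; rewrite expr2; under eq_fun do rewrite expr2.
  by apply: cvgM; apply: cvgB => //; exact: cvg_cst.
Qed.

(** Monotone iteration of the operator, started at the constant N above all
subsolutions. The constant N is an upper solution, hence the iterates decrease;
they stay above every subsolution, and their limit is a fixed point. *)
Lemma greatest_bounded_solution G p l z0 : bounded_measurable G -> bounded_measurable p ->
  subsolution G p l z0 ->
  exists2 b, bounded_solution (shifted_riccati G p l) b &
    forall z, subsolution G p l z -> forall t, z t <= b t.
Proof.
move=> bG bp sz0; have [_ [B hB]] := bG; have [_ [P hP]] := bp.
pose C := P + `|l|.
have hC t : `|p t| + `|l| <= C by rewrite lerD2r.
have B0 : 0 <= B by exact: le_trans (hB 0).
have C0 : 0 <= C by apply: le_trans (hC 0); rewrite addr_ge0.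
pose N := B + C + 1.
pose K := 2 * (N + B) + 1.
have K0 : 0 < K by rewrite /K /N; lra.
have hK : 2 * (N + B) <= K by rewrite /K; lra.
pose y_ n : R -> R := iter n (relaxation_step K G p l) (fun=> N).
have by_ n : bounded_measurable (y_ n).
  by elim: n => [|n IH]; [exact: bm_cst|exact: bm_step].
have y1 t : y_ 1 t <= N.
  have -> : N = (K * N) / K by field; rewrite gt_eqF.
  rewrite -(relax_cst _ t K0); apply: relax_le => //.
  - exact/bm_left_bounded/bm_step_arg/bm_cst.
  - exact/bm_left_bounded/bm_cst.
  - move=> s _; rewrite gerDr.
    apply: le_trans (shifted_riccati_le s hB hC _) _; rewrite /N; first by lra.
    rewrite (_ : B + C + 1 - B = C + 1) ?sqrrD1; last by ring.
    have := sqr_ge0 C; lra.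
have yN n t : y_ n t <= N.
  elim: n t => [|n IH] t; first exact: lexx.
  apply: le_trans (y1 t).
  exact: (relaxation_step_mono l K0 bG bp (by_ n) (bm_cst N) hB hK IH).
have ydec n t : y_ n.+1 t <= y_ n t.
  elim: n t => [|n IH] t; first exact: y1.
  exact: (relaxation_step_mono l K0 bG bp (by_ n.+1) (by_ n) hB hK IH (yN n)).
have zy z : subsolution G p l z -> forall n t, z t <= y_ n t.
  move=> sz; elim=> [|n IH] t; first exact: subsolution_le hB hC sz t.
  apply: le_trans (sz.2 K K0 t) _.
  exact: (relaxation_step_mono l K0 bG bp sz.1 (by_ n) hB hK IH (yN n)).
have ycv t : cvgn (y_ ^~ t).
  apply: nonincreasing_is_cvgn; first by apply/nonincreasing_seqP => n; exact: ydec.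
  by exists (z0 t) => _ [n _ <-]; exact: zy.
pose b t := limn (y_ ^~ t).
have zb z : subsolution G p l z -> forall t, z t <= b t.
  by move=> sz t; apply: limr_ge => //; apply: nearW => n; exact: zy.
have bN t : b t <= N by apply: limr_le => //; apply: nearW => n; exact: yN.
have [_ [M hM]] := sz0.1.
have yM n t : `|y_ n t| <= M + N.
  have := hM t; have := zy _ sz0 n t; have := yN n t; rewrite !ler_norml /N; lra.
have bmb : bounded_measurable b.
  split; first by apply: (measurable_fun_cvg (h := y_)) => [n|t _]; [exact: (by_ n).1|].
  exists (M + N) => t.
  have := hM t; have := zb _ sz0 t; have := bN t; rewrite !ler_norml /N; lra.
exists b => //; apply: (fixpoint_bounded_solution K0) => //.
apply: (@relaxation_step_limit G p l K (fun=> l) (fun n => y_ n.+1) y_ b (M + N) `|l|) => //.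
- by move=> n; exact: (by_ n).1.
- exact: cvg_cst.
- by move=> t; rewrite (cvg_shiftS (y_ ^~ t)); exact: ycv.
Qed.

End riccati.

(** * The bifurcation value *)

Section bifurcation.
Variable R : realType.
Local Notation mu := (@lebesgue_measure R).
Implicit Types (x y z g G p : R -> R) (K l : R).

(** If y solves the equation for G and p, then its time reversal solves the
equation for the time reversal of G and for p(- t): the form of the equation is
preserved, while attraction and repulsion, upper and lower, are exchanged. *)
Definition time_reversal y (t : R) : R := - y (- t).

Lemma time_reversalK y : time_reversal (time_reversal y) = y.
Proof. by apply/funext => t; rewrite /time_reversal !opprK. Qed.

Lemma bm_time_reversal y : bounded_measurable y -> bounded_measurable (time_reversal y).
Proof. by move=> by_; apply: bmN; exact: bm_opp. Qed.

Lemma bounded_solution_time_reversal G p l y : bounded_measurable G ->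
  bounded_measurable p -> bounded_solution (shifted_riccati G p l) y ->
  bounded_solution (shifted_riccati (time_reversal G) (fun t => p (- t)) l)
    (time_reversal y).
Proof.
move=> bG bp sy; have [ly [_ [M hM]]] := bounded_solution_loclip bG bp sy.
have [[_ dy] _] := sy; split; last first.
  by apply/bounded_funE; exists M => t; rewrite normrN.
split; first by move=> u v _; exact/loclip_ac/loclipN/loclip_opp.
move: (ae_opp dy); apply: aeS => t dt.
have := is_derive_oppf (is_derive_reflect dt).
by move=> /is_derive_eq; apply; rewrite /shifted_riccati /time_reversal; ring.
Qed.

(** The lower bound is the upper bound for the time-reversed equation. *)
Lemma bounded_solution_bound G p l (B C : R) y : bounded_measurable G ->
  bounded_measurable p ->
  (forall t, `|G t| <= B) -> (forall t, `|p t| + `|l| <= C) ->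
  bounded_solution (shifted_riccati G p l) y -> forall t, `|y t| <= B + C + 1.
Proof.
move=> bG bp hB hC sy t; rewrite ler_norml; apply/andP; split; last first.
  exact: subsolution_le hB hC (bounded_solution_subsolution bG bp sy) t.
have bG' := bm_time_reversal bG; have bp' := bm_opp bp.
have sy' := bounded_solution_subsolution bG' bp' (bounded_solution_time_reversal bG bp sy).
rewrite lerNl -[y t](congr1 y (opprK t)).
apply: (subsolution_le bG' bp' _ _ sy' (- t)) => s; last exact: hC.
by rewrite /time_reversal normrN.
Qed.

Lemma subsolution_param_le G p l l' z : bounded_measurable G -> bounded_measurable p ->
  l <= l' -> subsolution G p l z -> subsolution G p l' z.
Proof.
move=> bG bp ll [bz hz]; split=> // K K0 t; apply: le_trans (hz K K0 t) _.
apply: relax_le => //; try exact/bm_left_bounded/bm_step_arg.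
by move=> s _; rewrite lerD2r lerD2l.
Qed.

Definition has_bounded_solution G p l :=
  exists y, bounded_solution (shifted_riccati G p l) y.

Lemma subsolution_has_bounded_solution G p l z : bounded_measurable G ->
  bounded_measurable p -> subsolution G p l z -> has_bounded_solution G p l.
Proof. by move=> bG bp sz; have [b sb _] := greatest_bounded_solution bG bp sz; exists b. Qed.

Lemma has_bounded_solution_le G p l l' : bounded_measurable G -> bounded_measurable p ->
  l <= l' -> has_bounded_solution G p l -> has_bounded_solution G p l'.
Proof.
move=> bG bp ll [y sy]; apply: (subsolution_has_bounded_solution bG bp).
exact/(subsolution_param_le bG bp ll)/bounded_solution_subsolution/sy.
Qed.

(** For large parameters the constant 0 is a subsolution. *)
Lemma has_bounded_solution_large G p : bounded_measurable G -> bounded_measurable p ->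
  exists l, has_bounded_solution G p l.
Proof.
move=> bG bp; have [_ [B hB]] := bG; have [_ [P hP]] := bp.
exists (B ^+ 2 + P); apply: (@subsolution_has_bounded_solution _ _ _ (fun=> 0)) => //.
apply: ae_derive_subsolution => //; first exact: loclip_cst.
  by exists 0 => t; rewrite normr0.
apply: aeW => t; exists 0; first exact: is_derive_cst.
rewrite /shifted_riccati sub0r sqrrN.
have : G t ^+ 2 <= B ^+ 2.
  rewrite -(real_normK (num_real (G t))) lerXn2r ?nnegrE //.
  exact: le_trans (hB t).
have := hP t; rewrite ler_norml; lra.
Qed.

(** For very negative parameters the right-hand side is at most -1, and no
bounded function decreases at such a rate on the whole line. *)
Lemma has_bounded_solution_lb G p : bounded_measurable G -> bounded_measurable p ->
  exists m, forall l, has_bounded_solution G p l -> m <= l.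
Proof.
move=> bG bp; have [_ [P hP]] := bp; exists (- P - 1) => l [y sy].
rewrite leNgt; apply/negP => lt.
have [bmy hy] := bounded_solution_subsolution bG bp sy; have [_ [M hM]] := bmy.
have hs : has_sup (range y).
  split; first by exists (y 0), 0.
  by exists M => _ [t _ <-]; rewrite (le_trans (ler_norm _)).
have yS t : y t <= sup (range y) by apply: ub_le_sup; [exact: hs.2|exists t].
suff : sup (range y) <= sup (range y) - 1 by lra.
apply: ge_sup; first exact: hs.1.
move=> _ [t _ <-]; apply: le_trans (hy 1 ltr01 t) _.
rewrite -[leRHS]divr1 -(relax_cst _ t ltr01); apply: relax_le => //.
- exact/bm_left_bounded/bm_step_arg.
- exact/bm_left_bounded/bm_cst.
- move=> s _; rewrite mul1r /shifted_riccati.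
  have := sqr_ge0 (y s - G s); have := hP s; have := yS s; rewrite ler_norml; lra.
Qed.

(** Let l_ n decrease to the infimum. The greatest bounded solutions for l_ n
decrease with n, since a solution for a smaller parameter is a subsolution for
a larger one, and they are uniformly bounded. Their limit is a solution for the
infimum. *)
Lemma has_bounded_solution_inf G p : bounded_measurable G -> bounded_measurable p ->
  has_bounded_solution G p (inf [set l | has_bounded_solution G p l]).
Proof.
move=> bG bp; set S := [set l | _]; pose l0 := inf S.
have hS : has_inf S.
  split; first by have [l hl] := has_bounded_solution_large bG bp; exists l.
  by have [m hm] := has_bounded_solution_lb bG bp; exists m => l /hm.
pose l_ (n : nat) : R := l0 + n.+1%:R^-1.
have solvable n : has_bounded_solution G p (l_ n).
  have [|l Sl ll] := @inf_adherent _ S n.+1%:R^-1 _ hS; first by rewrite invr_gt0.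
  exact: (has_bounded_solution_le bG bp (ltW ll) Sl).
have greatest n : exists b, bounded_solution (shifted_riccati G p (l_ n)) b /\
    forall z, subsolution G p (l_ n) z -> forall t, z t <= b t.
  have [y sy] := solvable n.
  have [b sb hb] := greatest_bounded_solution bG bp (bounded_solution_subsolution bG bp sy).
  by exists b.
have [b_ hb_] := choice greatest.
have [_ [B hB]] := bG; have [_ [P hP]] := bp.
have lL n : `|l_ n| <= `|l0| + 1.
  rewrite (le_trans (ler_normD _ _)) // lerD2l ger0_norm ?invr_ge0 //.
  by rewrite invf_le1 // ler1n.
pose M := B + (P + (`|l0| + 1)) + 1.
have bM n t : `|b_ n t| <= M.
  apply: (bounded_solution_bound bG bp hB _ (hb_ n).1) => s.
  by rewrite lerD.
have bmb n : bounded_measurable (b_ n) by have [] := bounded_solution_loclip bG bp (hb_ n).1.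
have dec n t : b_ n.+1 t <= b_ n t.
  apply: (hb_ n).2; apply: (@subsolution_param_le _ _ (l_ n.+1)) => //.
    by rewrite lerD2l lef_pV2 ?posrE // ler_nat.
  exact: bounded_solution_subsolution (hb_ _).1.
have bcv t : cvgn (b_ ^~ t).
  apply: nonincreasing_is_cvgn; first by apply/nonincreasing_seqP => n; exact: dec.
  by exists (- M) => _ [n _ <-]; have := bM n t; rewrite ler_norml => /andP[].
pose b t := limn (b_ ^~ t).
have bmlim : bounded_measurable b.
  split.
    by apply: (measurable_fun_cvg (h := b_)) => [n|t _]; [exact: (bmb n).1|exact: bcv].
  exists M => t; rewrite ler_norml; apply/andP; split.
    apply: limr_ge => //; apply: nearW => n.
    by have := bM n t; rewrite ler_norml => /andP[].
  apply: limr_le => //; apply: nearW => n.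
  by have := bM n t; rewrite ler_norml => /andP[].
exists b; apply: (fixpoint_bounded_solution ltr01) => //.
apply: (@relaxation_step_limit R G p _ 1 l_ b_ b_ b M (`|l0| + 1)) => //.
- by move=> n; exact: (bmb n).1.
- rewrite -[X in _ --> X]addr0; apply: cvgD; first exact: cvg_cst.
  exact: cvg_harmonic.
- by move=> n; exact: (bounded_solution_fixpoint bG bp (hb_ n).1 ltr01).
Qed.

(** The set of admissible parameters is upwards closed and contains its
infimum; this is what makes the choice in the definition of [lambda_star]
meaningful. *)
Lemma lambda_star_shiftedP G p l : bounded_measurable G -> bounded_measurable p ->
  has_bounded_solution G p l <-> lambda_star_shifted G p <= l.
Proof.
move=> bG bp; rewrite /lambda_star_shifted /lambda_star.
have -> : riccati (fun t => 2 * G t) (fun t => p t - G t ^+ 2) = shifted_riccati G p.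
  apply/funext => l'; apply/funext => t; apply/funext => y.
  by rewrite /riccati /shifted_riccati; ring.
move: l; apply: (@getPex _ [set l0 | forall l, has_bounded_solution G p l <-> l0 <= l]).
exists (inf [set l | has_bounded_solution G p l]) => l; split=> [hl|ll].
  apply: ge_inf => //.
  by have [m hm] := has_bounded_solution_lb bG bp; exists m => l' /hm.
exact: has_bounded_solution_le ll (has_bounded_solution_inf bG bp).
Qed.

(** Since z - G1 = y - G2 for z = y - D, the operator for G1 maps z to
y - relax K (K D), and relax K (K D) is an average of the values of D on the
past, hence at most D, and less than D(t) at t if D was smaller before. *)
Lemma subsolution_sub_nondecreasing G1 G2 p l y : bounded_measurable G1 ->
  bounded_measurable G2 -> bounded_measurable p ->
  {homo (fun t => G2 t - G1 t) : s t / s <= t} ->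
  bounded_solution (shifted_riccati G2 p l) y ->
  subsolution G1 p l (fun t => y t - (G2 t - G1 t)) /\
  forall (K u t : R), 0 < K -> u < t -> G2 u - G1 u < G2 t - G1 t ->
    y t - (G2 t - G1 t) < relaxation_step K G1 p l (fun t => y t - (G2 t - G1 t)) t.
Proof.
move=> bG1 bG2 bp mono sy; set D := fun t => G2 t - G1 t.
have [_ bmy] := bounded_solution_loclip bG2 bp sy.
have bD : bounded_measurable D by exact: bmB.
have bz : bounded_measurable (fun t => y t - D t) by exact: bmB.
have stepE K t : 0 < K -> relaxation_step K G1 p l (fun t => y t - D t) t =
    y t - relax K (fun s => K * D s) t.
  move=> K0; rewrite [in RHS](bounded_solution_fixpoint bG2 bp sy K0).
  rewrite -relaxB //; last 2 first.
  - exact/bm_left_bounded/bm_step_arg.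
  - exact/bm_left_bounded/bmZ.
  congr relax; apply/funext => s; rewrite /shifted_riccati /D; ring.
have DE K t : 0 < K -> D t = relax K (fun=> K * D t) t.
  by move=> K0; rewrite relax_cst // mulrC mulKf // gt_eqF.
split; first split; first exact: bz.
  move=> K K0 t; rewrite stepE // -/(D t).
  rewrite lerD2l lerN2 [leRHS](DE K) //; apply: relax_le => //.
  - exact/bm_left_bounded/bmZ.
  - exact/bm_left_bounded/bm_cst.
  - by move=> s st; rewrite ler_pM2l // mono.
move=> K u t K0 ut Dut; rewrite stepE // -/(D t).
rewrite ltrD2l ltrN2 [ltRHS](DE K) //.
apply: (@relax_lt _ _ _ _ u _ (K * (D t - D u))) => //.
- exact/bm_left_bounded/bmZ.
- exact/bm_left_bounded/bm_cst.
- by move=> s st; rewrite ler_pM2l // mono.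
- exact: ltW.
- by rewrite mulr_gt0 // subr_gt0.
- by move=> s su; rewrite -mulrDr ler_pM2l // -lerBrDr opprB subrKC mono.
Qed.

Lemma lambda_star_le G1 G2 p : bounded_measurable G1 ->
  bounded_measurable G2 -> bounded_measurable p ->
  {homo (fun t => G2 t - G1 t) : s t / s <= t} ->
  lambda_star_shifted G1 p <= lambda_star_shifted G2 p.
Proof.
move=> bG1 bG2 bp mono; apply/lambda_star_shiftedP => //.
have [y sy] := (lambda_star_shiftedP (lambda_star_shifted G2 p) bG2 bp).2 (lexx _).
have [sz _] := subsolution_sub_nondecreasing bG1 bG2 bp mono sy.
exact: subsolution_has_bounded_solution sz.
Qed.

End bifurcation.

(** * Antiderivatives of bounded measurable functions *)

Section potential.
Variable R : realType.
Local Notation mu := (@lebesgue_measure R).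
Implicit Types (c : R -> R).

Lemma bm_integrable_itv c (a b : R) : bounded_measurable c ->
  mu.-integrable `[a, b] (EFin \o c).
Proof.
move=> [mc [M hM]]; apply: measurable_bounded_integrable => //.
- rewrite -[X in (X < _)%E]/(mu `[a, b]) lebesgue_measure_itv /=.
  by case: ifP => // _; rewrite -EFinB ltry.
- exact: measurable_funTS.
- by exists M; split=> [|N MN t _ /=]; [exact: num_real|rewrite (le_trans (hM t)) // ltW].
Qed.

Lemma oriented_integralE c (a s t : R) : bounded_measurable c -> a <= s -> a <= t ->
  oriented_integral s t c =
  \int[mu]_(r in `[a, t]) c r - \int[mu]_(r in `[a, s]) c r.
Proof.
move=> bc; wlog st : s t / s <= t => [H as_ at_|as_ at_].
  have [st|/[dup] ts /ltW ts'] := leP s t; first exact: H.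
  rewrite -[RHS]opprB -H // /oriented_integral ts'.
  by rewrite leNgt ts.
rewrite /oriented_integral st Rintegral_itvB ?bnd_simp //; last exact: bm_integrable_itv.
rewrite Rintegral_itv_obnd_cbnd //.
by apply: (@integrableS _ _ _ mu `[s, t]) => //;
  [exact: subset_itv_oc_cc|exact: bm_integrable_itv].
Qed.

(** An antiderivative of c on the whole line, obtained from the
differentiation theorem on the half-lines [-n, +oo[. *)
Lemma potential_of_bounded_measurable c : bounded_measurable c ->
  exists C, [/\ locally_lipschitz C,
    {ae mu, forall t : R, is_derive t 1 C (c t)} &
    forall s t, oriented_integral s t c = C t - C s].
Proof.
move=> bc; pose C t := oriented_integral 0 t c.
have CE s t : oriented_integral s t c = C t - C s.
  pose a := Num.min 0 (Num.min s t).
  have a0 : a <= 0 by rewrite ge_min lexx.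
  have as_ : a <= s by rewrite !ge_min lexx orbT.
  have at_ : a <= t by rewrite !ge_min lexx !orbT.
  by rewrite /C !(oriented_integralE (a := a)) //; ring.
have [_ [M hM]] := bc.
exists C; split=> //.
- move=> A; exists `|M| => // s t _ _; rewrite -CE.
  have bnd (u v : R) : u <= v -> `|\int[mu]_(r in `[u, v]) c r| <= `|M| * `|v - u|.
    move=> uv; have ic := bm_integrable_itv u v bc.
    rewrite (le_trans (le_normr_Rintegral _ ic)) //.
    have muE : fine (mu `[u, v]) = `|v - u|.
      rewrite lebesgue_measure_itv /= lte_fin ger0_norm ?subr_ge0 //.
      by case: ltgtP uv => // -> _; rewrite subrr.
    rewrite -muE -Rintegral_cst //; apply: le_Rintegral => //.
    + exact: integrable_norm ic.
    + exact/bm_integrable_itv/bm_cst.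
    + by move=> r _; rewrite (le_trans (hM r)) // ler_norm.
  rewrite /oriented_integral; have [st|/ltW ts] := leP s t; first exact: bnd.
  by rewrite normrN distrC; exact: bnd.
pose Q (n : nat) (t : R) := \int[mu]_(r in `[- n%:R, t]) c r.
have loc : locally_integrable [set: R] c.
  split; [exact: bc.1|exact: openT|].
  move=> K _ cK; have /compact_bounded[N [_ hN]] := cK.
  have KN : K `<=` `[- (N + 1), (N + 1)].
    by move=> s /(hN (N + 1)); rewrite ltrDl ltr01 /= in_itv /= -ler_norml => /(_ isT).
  have /integrableP[_] := bm_integrable_itv (- (N + 1)) (N + 1) bc.
  apply: le_lt_trans; apply: ge0_subset_integral => //.
    exact: compact_measurable.
  apply/measurable_EFinP; apply: measurable_funTS.
  by apply: measurableT_comp => //; exact: bc.1.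
have Qder n : {ae mu, forall t : R, - n%:R < t -> is_derive t 1 (Q n) (c t)}.
  have H := @FTC1 R c (BLeft (- n%:R)) (fun y => bm_integrable_itv _ y bc) loc.
  move: H; apply: (@aeS R) => t H nt.
  have [|dx Dx] := H; first by rewrite lte_fin.
  by split; rewrite -?derive1E.
move: (ae_foralln Qder); apply: (@aeS R) => t Ht.
have [n nt] : exists n : nat, `|t| < n%:R.
  by exists (Num.bound `|t|); exact: archi_boundP.
have nt' : - n%:R < t by move: nt; rewrite ltr_norml => /andP[].
have H := Ht n nt'.
have H2 := is_derive_addf H (is_derive_cst (- Q n 0) t 1).
rewrite addr0 in H2.
apply: near_eq_is_derive H2.
near=> s; rewrite /C (oriented_integralE (a := - n%:R)) // ?oppr_le0 //.
by apply: ltW; near: s; exact: lt_nbhsr.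
Unshelve. all: by end_near. Qed.

End potential.

(** * Coexistence of bounded solutions and absence of hyperbolic ones *)

Section structure.
Variable R : realType.
Local Notation mu := (@lebesgue_measure R).
Implicit Types (x y z g G p : R -> R) (K l : R).

Lemma infinite_range_nat (T : Type) (f : nat -> T) : injective f ->
  infinite_set (range f).
Proof.
move=> fi; apply/infiniteP.
have : (range f #= [set: nat])%card by apply: inj_card_eq => m n _ _; exact: fi.
by rewrite card_eq_le => /andP[].
Qed.

(** With d = b - a, the function x = a + w solves the Riccati equation when w
solves the Bernoulli equation w' = -2 (a - G) w - w^2. One solution is w = d;
passing to 1 / w makes the equation linear, and its other solutions are
w = d / (1 + n h d), where h = exp (int 2 (a - G)). Written this way the formula
makes sense also where d vanishes, and 0 <= w <= d. *)
Lemma infinitely_many_between G p l a b (v : R) : bounded_measurable G ->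
  bounded_measurable p ->
  bounded_solution (shifted_riccati G p l) a ->
  bounded_solution (shifted_riccati G p l) b ->
  (forall t, a t <= b t) -> a v < b v ->
  infinite_set [set y | bounded_solution (shifted_riccati G p l) y].
Proof.
move=> bG bp sa sb ab abv.
have [la bma] := bounded_solution_loclip bG bp sa.
have [lb bmb] := bounded_solution_loclip bG bp sb.
have [H [lH dH _]] := potential_of_bounded_measurable (bmZ 2 (bmB bma bG)).
pose h t := expR (H t).
pose d t := b t - a t.
have d0 t : 0 <= d t by rewrite subr_ge0.
pose q (n : nat) t := 1 + n%:R * (h t * d t).
have q1 n t : 1 <= q n t by rewrite lerDl !mulr_ge0 ?expR_ge0.
pose y n t := a t + d t * (q n t)^-1.
have lq n : locally_lipschitz (q n).
  apply: loclipD; first exact: loclip_cst.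
  apply: loclipZ; apply: loclipM; first exact: loclip_expR.
  exact: loclipB.
have ly n : locally_lipschitz (y n).
  by apply: loclipD => //; apply: loclipM; [exact: loclipB|exact: loclipV].
have sy n : bounded_solution (shifted_riccati G p l) (y n).
  split; [split|].
  - by move=> u w _; exact: loclip_ac.
  - have [[_ da] _] := sa; have [[_ db] _] := sb.
    apply: (@aeS2 R) da (aeS2 (fun t h1 h2 => conj h1 h2) db dH) => t dat [dbt dHt].
    have dd := is_derive_addf dbt (is_derive_oppf dat).
    have dq := is_derive_addf (is_derive_cst (1 : R) t 1)
      (is_derive_scalef n%:R (is_derive_mulf (is_derive_expRf dHt) dd)).
    have q0 : q n t != 0 by rewrite gt_eqF // (lt_le_trans _ (q1 n t)).
    have := is_derive_addf dat (is_derive_mulf dd (is_derive_invf q0 dq)).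
    move=> /is_derive_eq; apply; move: q0.
    rewrite /y /q /d /h /shifted_riccati => q0; field.
    exact: q0.
  - apply/bounded_funE.
    have [_ [M hM]] := bma; have [_ [N hN]] := bmb.
    exists (M + (N + M)) => t; rewrite (le_trans (ler_normD _ _)) // lerD //.
    rewrite normrM (@le_trans _ _ `|d t|) //; last first.
      by rewrite (le_trans (ler_normB _ _)) // lerD.
    rewrite ler_piMr // ger0_norm ?invr_ge0 ?(le_trans ler01) //.
    by rewrite invf_le1 // (lt_le_trans _ (q1 n t)).
apply: (@sub_infinite_set _ (range y)); first by move=> _ [n _ <-]; exact: sy.
apply: infinite_range_nat => m n /(congr1 (fun f => f v)) /addrI.
have dv : d v != 0 by rewrite gt_eqF // subr_gt0.
move=> /(mulfI dv) /invr_inj /addrI.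
have hdv : h v * d v != 0 by rewrite mulf_neq0 // gt_eqF // expR_gt0.
by move=> /(mulIf hdv) /eqP; rewrite eqr_nat => /eqP.
Qed.

(** Let c = -2 y + 2 G. Attraction makes
phi(t) = int_(-oo)^t exp (C t - C s) ds a bounded solution of
phi' = c phi + 1. Moving from y to y - de phi changes the right-hand side of
the equation by - de c phi - de^2 phi^2 and the derivative by
- de (c phi + 1): for small de there is a gain of order de, which pays for a
decrease of the parameter. *)
Lemma attractive_perturbation G p l y (C : R -> R) (k be : R) :
  bounded_measurable G -> bounded_measurable p ->
  bounded_solution (shifted_riccati G p l) y ->
  locally_lipschitz C ->
  {ae mu, forall t : R, is_derive t 1 C (- 2 * y t + 2 * G t)} ->
  1 <= k -> 0 < be ->
  (forall s t, s <= t -> expR (C t - C s) <= k * expR (- be * (t - s))) ->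
  exists2 e : R, 0 < e & has_bounded_solution G p (l - e).
Proof.
move=> bG bp sy lC dC k1 be0 hC.
have [ly [_ [M hM]]] := bounded_solution_loclip bG bp sy.
have [[_ dy] _] := sy.
have lexp : locally_lipschitz (fun s => C s + be * s).
  by apply: loclipD => //; apply: loclipZ; exact: loclip_id.
pose g s := expR (- (C s + be * s)).
have gle s t : s <= t -> g s <= k * g t.
  move=> st; have := hC s t st.
  rewrite -(ler_pM2r (expR_gt0 (- (C t + be * s)))) -expRD -mulrA -expRD.
  by congr (expR _ <= k * expR _); ring.
have lg : left_bounded g.
  split; first by apply: loclip_measurable; apply: loclip_expR; exact: loclipN.
  move=> A; exists (k * g A) => t tA; rewrite ger0_norm ?expR_ge0 //; exact: gle.
pose phi t := expR (C t + be * t) * relax be g t.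
have lphi : locally_lipschitz phi.
  by apply: loclipM; [exact: loclip_expR|exact: relax_loclip].
have lc c := bm_left_bounded (@bm_cst R c).
have phi0 t : 0 <= phi t.
  rewrite mulr_ge0 ?expR_ge0 // -[leLHS](mul0r be^-1) -(relax_cst _ t be0).
  by apply: relax_le => // s _; exact: expR_ge0.
have phik t : phi t <= k / be.
  have : relax be g t <= k * g t / be.
    by rewrite -(relax_cst _ t be0); apply: relax_le => // s; exact: gle.
  rewrite -(ler_pM2l (expR_gt0 (C t + be * t))) => /le_trans; apply.
  rewrite /g expRN le_eqVlt; apply/orP; left; apply/eqP; field.
  by rewrite !gt_eqF ?expR_gt0.
have dphi : {ae mu, forall t : R,
    is_derive t 1 phi ((- 2 * y t + 2 * G t) * phi t + 1)}.
  apply: (@aeS2 R) dC (relax_ae_derive be0 lg) => t dCt dr.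
  have := is_derive_mulf (is_derive_expRf
    (is_derive_addf dCt (is_derive_lin be t))) dr.
  move=> /is_derive_eq; apply; rewrite /phi /g expRN; field.
  by rewrite gt_eqF ?expR_gt0.
pose c := k / be.
have c0 : 0 < c by rewrite divr_gt0 // (lt_le_trans _ k1).
(* This value maximises the gain de - de^2 c^2, which is then de / 2. *)
pose de := (2 * c ^+ 2)^-1.
have de0 : 0 < de by rewrite invr_gt0 mulr_gt0 // exprn_gt0.
have dec : de * c ^+ 2 = 1 / 2 by rewrite /de; field; rewrite gt_eqF.
exists (de / 2); first by rewrite divr_gt0.
apply: (@subsolution_has_bounded_solution R G p _ (fun t => y t - de * phi t)) => //.
apply: ae_derive_subsolution => //.
- by apply: loclipB => //; exact: loclipZ.
- exists (M + de * c) => t; rewrite (le_trans (ler_normB _ _)) // lerD //.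
  by rewrite normrM !ger0_norm ?(ltW de0) // ler_wpM2l ?(ltW de0).
apply: (@aeS2 R) dy dphi => t dyt dpt.
exists (shifted_riccati G p l t (y t) -
   de * ((- 2 * y t + 2 * G t) * phi t + 1)).
  exact: is_derive_addf dyt (is_derive_oppf (is_derive_scalef de dpt)).
rewrite -subr_ge0 /shifted_riccati.
have -> : - (y t - de * phi t - G t) ^+ 2 + p t + (l - de / 2) -
  (- (y t - G t) ^+ 2 + p t + l - de * ((- 2 * y t + 2 * G t) * phi t + 1)) =
  de * (1 / 2 - de * phi t ^+ 2) by field.
rewrite mulr_ge0 ?(ltW de0) // -dec subr_ge0 ler_wpM2l ?(ltW de0) //.
by rewrite lerXn2r ?nnegrE ?(ltW c0) //; exact: phik.
Qed.

(** Time reversal exchanges the two cases in the definition of hyperbolicity. *)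
Lemma hyperbolic_perturbation G p l y :
  bounded_measurable G -> bounded_measurable p ->
  bounded_solution (shifted_riccati G p l) y -> hyperbolic G y ->
  exists2 e : R, 0 < e & has_bounded_solution G p (l - e).
Proof.
move=> bG bp sy [k [be [k1 be0 hyp]]].
have [ly bmy] := bounded_solution_loclip bG bp sy.
have [C [lC dC CE]] := potential_of_bounded_measurable (bmD (bmZ (- 2) bmy) (bmZ 2 bG)).
case: hyp => hyp.
  apply: (attractive_perturbation bG bp sy lC dC k1 be0) => s t st.
  by rewrite -CE; exact: hyp.
have bG' := bm_time_reversal bG; have bp' := bm_opp bp.
have [||e e0 [x sx]] := attractive_perturbation bG' bp'
  (bounded_solution_time_reversal bG bp sy) (loclip_opp lC) _ k1 be0.
- move: (ae_opp dC); apply: (@aeS R) => t dt.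
  move: (is_derive_reflect dt) => /is_derive_eq; apply.
  by rewrite /time_reversal; ring.
- move=> s t st; rewrite -CE (le_trans (hyp _ _ _)) ?lerN2 //.
  by rewrite (_ : be * (- t - - s) = - be * (t - s)) //; ring.
exists e => //; exists (time_reversal x).
have := bounded_solution_time_reversal bG' bp' sx.
rewrite time_reversalK.
by under eq_fun do rewrite opprK.
Qed.

Lemma lambda_star_not_hyperbolic G p y :
  bounded_measurable G -> bounded_measurable p ->
  bounded_solution (shifted_riccati G p (lambda_star_shifted G p)) y ->
  ~ hyperbolic G y.
Proof.
move=> bG bp sy /(hyperbolic_perturbation bG bp sy)[e e0].
by move=> /(lambda_star_shiftedP _ bG bp); rewrite lerBrDr gerDl leNgt e0.
Qed.

(** The function z = y - D lies strictly below the greatest bounded solution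
at v and, by time reversal, above the least one. *)
Lemma infinitely_many_of_nonconstant G1 G2 p l (u v : R) : bounded_measurable G1 ->
  bounded_measurable G2 -> bounded_measurable p ->
  {homo (fun t => G2 t - G1 t) : s t / s <= t} ->
  u < v -> G2 u - G1 u < G2 v - G1 v ->
  has_bounded_solution G2 p l ->
  infinite_set [set y | bounded_solution (shifted_riccati G1 p l) y].
Proof.
move=> bG1 bG2 bp mono uv Duv [y sy].
have [sz zlt] := subsolution_sub_nondecreasing bG1 bG2 bp mono sy.
have [b sb hb] := greatest_bounded_solution bG1 bp sz.
have bG1' := bm_time_reversal bG1; have bG2' := bm_time_reversal bG2.
have bp' := bm_opp bp.
have mono' : {homo (fun t => time_reversal G2 t - time_reversal G1 t) : s t / s <= t}.
  move=> s t st; have := mono (- t) (- s); rewrite lerN2 => /(_ st).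
  by rewrite /time_reversal; lra.
have [sz' _] := subsolution_sub_nondecreasing bG1' bG2' bp' mono'
  (bounded_solution_time_reversal bG2 bp sy).
have [a' sa' ha'] := greatest_bounded_solution bG1' bp' sz'.
have sa : bounded_solution (shifted_riccati G1 p l) (time_reversal a').
  have := bounded_solution_time_reversal bG1' bp' sa'.
  by rewrite time_reversalK; under eq_fun do rewrite opprK.
have az t : time_reversal a' t <= y t - (G2 t - G1 t).
  have := ha' _ sz' (- t); rewrite /time_reversal !opprK; lra.
apply: (@infinitely_many_between G1 p l (time_reversal a') b v) => //.
  by move=> t; apply: le_trans (az t) (hb _ sz t).
apply: le_lt_trans (az v) _.
have [_ bmb] := bounded_solution_loclip bG1 bp sb.
have [_ [B hB]] := bG1; have [_ [S hS]] := bmb.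
pose K := `|2 * (S + B)| + 1.
have K0 : 0 < K by rewrite ltr_wpDl.
apply: lt_le_trans (zlt K u v K0 uv Duv) _.
rewrite [leRHS](bounded_solution_fixpoint bG1 bp sb K0).
apply: (relaxation_step_mono l K0 bG1 bp sz.1 bmb hB (S := S)).
- by rewrite (le_trans (ler_norm _)) // lerDl.
- exact: hb _ sz.
- by move=> s; rewrite (le_trans (ler_norm _)).
Qed.

End structure.

(** * Comparison of the bifurcation values *)

Theorem theorem3p7 (R : realType) (G1 G2 p : R -> R)
    (hG1 : BPUC G1) (hG2 : BPUC G2) (hp : BPUC p)
    (hmono : {homo (fun t : R => G2 t - G1 t) : s t / s <= t}) :
  let D := fun t : R => G2 t - G1 t in
  let lambda1 := lambda_star_shifted G1 p in
  let lambda2 := lambda_star_shifted G2 p in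
  let Gmu := fun mu t : R => mu * G1 t + (1 - mu) * G2 t in
  (continuous D ->
    lambda1 <= lambda2 /\
    ((exists u v : R, [/\ u < v, abs_continuous u v D &
        exists s t : R, [/\ s \in `[u, v], t \in `[u, v] & D s != D t]]) ->
     lambda1 = lambda2 ->
     infinitely_many_bounded_none_hyperbolic G1 p lambda1 /\
     forall mu : R, 0 < mu < 1 ->
       infinitely_many_bounded_none_hyperbolic (Gmu mu) p
         (lambda_star_shifted (Gmu mu) p))) /\
  (cvg (G1 t @[t --> -oo]) -> cvg (G1 t @[t --> +oo]) ->
   cvg (G2 t @[t --> -oo]) -> cvg (G2 t @[t --> +oo]) ->
   lambda1 <= lambda2).
Proof.
move=> D lambda1 lambda2 Gmu.
have bG1 := BPUC_bounded_measurable hG1.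
have bG2 := BPUC_bounded_measurable hG2.
have bp := BPUC_bounded_measurable hp.
have le12 : lambda1 <= lambda2 by exact: lambda_star_le.
have solvable G : bounded_measurable G -> has_bounded_solution G p (lambda_star_shifted G p).
  by move=> bG; exact/lambda_star_shiftedP.
split=> [_|_ _ _ _ //]; split=> // -[u [v [_ _ [s0 [t0 [_ _ Dst]]]]]] l12.
have [s [t [st Dlt]]] : exists s t, s < t /\ D s < D t.
  case: (ltgtP s0 t0) => [lt|gt|e].
  - by exists s0, t0; split=> //; rewrite lt_neqAle Dst; apply: hmono; exact: ltW.
  - by exists t0, s0; split=> //; rewrite lt_neqAle eq_sym Dst; apply: hmono; exact: ltW.
  - by move: Dst; rewrite e eqxx.
split.
  split; last by move=> y; exact: lambda_star_not_hyperbolic.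
  apply: (infinitely_many_of_nonconstant bG1 bG2 bp hmono st Dlt).
  by rewrite l12; exact: solvable.
move=> m /andP[m0 m1].
have bGm : bounded_measurable (Gmu m) by apply: bmD; exact: bmZ.
have ge1 : lambda1 <= lambda_star_shifted (Gmu m) p.
  apply: lambda_star_le => // a b ab.
  have DE r : Gmu m r - G1 r = (1 - m) * D r by rewrite /D /Gmu; ring.
  by rewrite !DE ler_wpM2l ?subr_ge0 ?(ltW m1) //; exact: hmono.
have DmE r : G2 r - Gmu m r = m * D r by rewrite /D /Gmu; ring.
have monom : {homo (fun r => G2 r - Gmu m r) : a b / a <= b}.
  by move=> a b ab; rewrite !DmE ler_wpM2l ?(ltW m0) //; exact: hmono.
have le2 : lambda_star_shifted (Gmu m) p <= lambda2 by exact: lambda_star_le.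
have lE : lambda_star_shifted (Gmu m) p = lambda2.
  by apply/eqP; rewrite eq_le le2 -l12.
split; last by move=> y; exact: lambda_star_not_hyperbolic.
apply: (infinitely_many_of_nonconstant bGm bG2 bp monom st).
  by rewrite !DmE ltr_pM2l.
by rewrite lE; exact: solvable.
Qed.
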